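(* There is an algorithm that, given a residually finite group $G$, given by a finite presentation $\langle S\mid R\rangle$, and a self-adjoint matrix $A\in M_{n\times n}(\mathbb{Z}G)$ (with $n\in\mathbb{N}$), given as an element of $M_{n\times n}(\mathbb{Z}[S^*])$, outputs a computable sequence witnessing that $b^{(2)}(A;G)$ is effectively computable, i.e., an algorithm for computing a sequence $(q_k)_{k\in\mathbb{N}}$ of rational numbers such that for all $k\in\mathbb{N}$ we have $$\bigl|b^{(2)}(A;G)-q_k\bigr|\le2^{-k}.$$ In particular, in this situation, the $L^2$-Betti number $b^{(2)}(A;G)$ is effectively computable.
   Context: $S^*$ is the set of words in the elements of $S$ and their formal inverses, and $\mathbb{Z}[S^*]$ is the set of finite $\mathbb{Z}$-linear combinations of such words; elements of $M_{n\times n}(\mathbb{Z}[S^*])$ represent matrices over $\mathbb{Z}G$. $\ell^2G$ is the Hilbert space of square-summable functions $G\to\mathbb{C}$; $R_A^{(2)}:(\ell^2G)^n\to(\ell^2G)^n$ is right multiplication by $A$, and $b^{(2)}(A;G):=\dim_{\mathcal{R}G}\ker(R_A^{(2)})$, where for a closed $G$-invariant subspace $V\subset(\ell^2G)^n$ with orthogonal projection $P_V$, $\dim_{\mathcal{R}G}V=\sum_{i=1}^n\langle P_V(e_i),e_i\rangle$ ($e_i$ has $\delta_e$ in position $i$ and $0$ elsewhere). $A$ is self-adjoint if it equals its transpose with the entrywise involution $\sum a_gg\mapsto\sum a_gg^{-1}$ applied. A real $r$ is effectively computable if there is a computable sequence $q:\mathbb{N}\to\mathbb{Q}$ with $|r-q_k|\le2^{-k}$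 for all $k\in\mathbb{N}$. *)

(* Defs.v *)
From HB Require Import structures.
From mathcomp Require Import all_boot all_order all_algebra finmap.
From mathcomp Require Import fingroup complex.
From mathcomp Require Import all_classical all_reals all_analysis.
From mathcomp Require summability.
From Stdlib Require Arith.Cantor.

Set Implicit Arguments.
Unset Strict Implicit.
Unset Printing Implicit Defensive.

Import Order.TTheory GRing.Theory Num.Theory.
Import numFieldNormedType.Exports.

Local Open Scope ring_scope.

(** Kleene's partial recursive functions, made unary by means of the bijective
    Cantor pairing [Cantor.to_nat : nat * nat -> nat]. *)
Inductive prog : Type :=
  | Zero
  | Succ
  | Fst
  | Snd
  | Pair of prog & prog
  | Comp of prog & prog
  | Prec of prog & prog
  | Mu of prog.

(** Graph of the function defined by primitive recursion from the graphs of
    the base case [F] (applied to a) and of the step [G] (applied to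
    <a, <y, value at y>>). *)
Fixpoint prec_graph (F G : nat -> nat -> Prop) (a y v : nat) : Prop :=
  if y is y'.+1 then
    exists2 u, prec_graph F G a y' u &
               G (Cantor.to_nat (a, Cantor.to_nat (y', u))) v
  else F a v.

Fixpoint run (p : prog) (x v : nat) : Prop :=
  match p with
  | Zero => v = 0%N
  | Succ => v = x.+1
  | Fst => v = (Cantor.of_nat x).1
  | Snd => v = (Cantor.of_nat x).2
  | Pair p1 p2 => exists v1 v2,
      [/\ run p1 x v1, run p2 x v2 & v = Cantor.to_nat (v1, v2)]
  | Comp p1 p2 => exists2 u, run p2 x u & run p1 u v
  | Prec p1 p2 =>
      prec_graph (run p1) (run p2) (Cantor.of_nat x).1 (Cantor.of_nat x).2 v
  | Mu p1 =>
      run p1 (Cantor.to_nat (x, v)) 0%N /\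
      forall i : nat, (i < v)%N -> exists u, run p1 (Cantor.to_nat (x, i)) u.+1
  end.

Definition enc_pair (a b : nat) : nat := Cantor.to_nat (a, b).

Definition enc_seq (s : seq nat) : nat :=
  foldr (fun a c => (enc_pair a c).+1) 0%N s.

Definition enc_int (z : int) : nat :=
  match z with Posz k => enc_pair 0 k | Negz k => enc_pair 1 k end.

(** <<a, b>, d> stands for (a - b) / (d + 1); every rational number arises. *)
Definition dec_rat (c : nat) : rat :=
  let: (u, d) := Cantor.of_nat c in
  let: (a, b) := Cantor.of_nat u in
  (a%:R - b%:R) / d.+1%:R.

Fixpoint enc_prog (p : prog) : nat :=
  match p with
  | Zero => enc_pair 0 0
  | Succ => enc_pair 1 0
  | Fst => enc_pair 2 0
  | Snd => enc_pair 3 0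
  | Pair p1 p2 => enc_pair 4 (enc_pair (enc_prog p1) (enc_prog p2))
  | Comp p1 p2 => enc_pair 5 (enc_pair (enc_prog p1) (enc_prog p2))
  | Prec p1 p2 => enc_pair 6 (enc_pair (enc_prog p1) (enc_prog p2))
  | Mu p1 => enc_pair 7 (enc_prog p1)
  end.

Definition computes (p : prog) (q : nat -> rat) : Prop :=
  forall k : nat, exists2 c, run p k c & dec_rat c = q k.

Definition computable_seq (q : nat -> rat) : Prop := exists p, computes p q.

Definition approximates (R : realType) (q : nat -> rat) (r : R) : Prop :=
  forall k : nat, `|r - ratr (q k)| <= 2 ^- k.

Definition effectively_computable (R : realType) (r : R) : Prop :=
  exists2 q, computable_seq q & approximates q r.

(** The generating set S is {0, ..., m-1}; the letter (i, false) is the i-th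
    generator and (i, true) its formal inverse. *)
Definition letter (m : nat) : Type := ('I_m * bool)%type.
Definition word (m : nat) : Type := seq (letter m).

Record presentation := Presentation {
  ngen : nat;
  relators : seq (word ngen)
}.

(** Equality of words in <S | R>: the congruence on S^* generated by the free
    cancellations and by r = 1 for r in R. *)
Inductive pres_eq (P : presentation) : word (ngen P) -> word (ngen P) -> Prop :=
  | pres_refl w : pres_eq w w
  | pres_sym w1 w2 : pres_eq w1 w2 -> pres_eq w2 w1
  | pres_trans w1 w2 w3 : pres_eq w1 w2 -> pres_eq w2 w3 -> pres_eq w1 w3
  | pres_cat w1 w2 w3 w4 :
      pres_eq w1 w2 -> pres_eq w3 w4 -> pres_eq (w1 ++ w3) (w2 ++ w4)
  | pres_cancel i b : pres_eq [:: (i, b); (i, ~~ b)] [::]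
  | pres_rel r : r \in relators P -> pres_eq r [::].

Definition letter_val (m : nat) (G : groupType) (s : 'I_m -> G) (l : letter m) : G :=
  (if l.2 then (s l.1)^-1 else s l.1)%g.

Definition word_val (m : nat) (G : groupType) (s : 'I_m -> G) (w : word m) : G :=
  (\prod_(l <- w) letter_val s l)%g.

(** The generators [s] induce an isomorphism from <S | R> to G. *)
Definition presents (P : presentation) (G : groupType) (s : 'I_(ngen P) -> G) : Prop :=
  (forall g : G, exists w, word_val s w = g) /\
  (forall w1 w2, word_val s w1 = word_val s w2 <-> pres_eq w1 w2).

Definition residually_finite (G : groupType) : Prop :=
  forall g : G, g != 1%g ->
  exists (H : finGroupType) (f : {multiplicative G -> H}), f g != 1%g.

Definition group_ring (G : groupType) : Type := {fsfun G -> int with 0}.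

(** The involution sum a_g g |-> sum a_g g^-1. *)
Definition gr_star (G : groupType) (a : group_ring G) : group_ring G :=
  [fsfun g in [fset (h^-1)%g | h in finsupp a]%fset => a (g^-1)%g | 0].

Definition self_adjoint (G : groupType) (n : nat) (A : 'M[group_ring G]_n) : Prop :=
  A = \matrix_(i, j) gr_star (A j i).

(** A finite Z-linear combination of words, as a list of coefficients and words
    (in any order, possibly with repeated words or zero coefficients). *)
Definition formal_sum (m : nat) : Type := seq (int * word m).

Definition gr_of_sum (m : nat) (G : groupType) (s : 'I_m -> G)
    (a : formal_sum m) : group_ring G :=
  [fsfun g in [fset word_val s t.2 | t in a]%fset =>
     \sum_(t <- a | word_val s t.2 == g) t.1 | 0].

Definition gr_mx (m : nat) (G : groupType) (s : 'I_m -> G) (n : nat)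
    (B : 'M[formal_sum m]_n) : 'M[group_ring G]_n :=
  \matrix_(i, j) gr_of_sum s (B i j).

Definition enc_word (m : nat) (w : word m) : nat :=
  enc_seq [seq enc_pair (l.1 : 'I_m) (l.2 : bool) | l <- w].

Definition enc_presentation (P : presentation) : nat :=
  enc_pair (ngen P) (enc_seq [seq enc_word r | r <- relators P]).

Definition enc_sum (m : nat) (a : formal_sum m) : nat :=
  enc_seq [seq enc_pair (enc_int t.1) (enc_word t.2) | t <- a].

Definition enc_mx (m n : nat) (B : 'M[formal_sum m]_n) : nat :=
  enc_pair n
    (enc_seq [seq enc_seq [seq enc_sum (B i j) | j <- enum 'I_n] | i <- enum 'I_n]).

Local Open Scope classical_set_scope.

Section L2.
Variables (R : realType) (G : groupType) (n : nat).

Definition tuple_fun : Type := 'I_n -> G -> R[i].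

Definition l2 : set tuple_fun :=
  [set x : tuple_fun |
    forall i, summable [set: G] (fun g => (ComplexField.Normc.normc (x i g) ^+ 2)%:E)].

(** [summability.sum] is the limit of the net of finite partial sums; on [l2]
    this unordered series converges absolutely. *)
Definition inner (x y : tuple_fun) : R[i] :=
  \sum_(i < n) summability.sum (fun g : G => x i g * (y i g)^* : R[i]^o).

Definition is_orth_proj (V : set tuple_fun) (x p : tuple_fun) : Prop :=
  V p /\ forall v, V v -> inner (fun i g => x i g - p i g) v = 0.

(** Meaningful when [V] is a closed subspace of [l2]: the projection then
    exists and is unique. *)
Definition orth_proj (V : set tuple_fun) (x : tuple_fun) : tuple_fun :=
  xget (fun _ _ => 0) [set p | is_orth_proj V x p].

Definition unit_vec (i : 'I_n) : tuple_fun :=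
  fun j g => ((j == i) && (g == 1%g))%:R.

(** The sum of the <P_V e_i, e_i> is a nonnegative real number, so that taking
    the real part only changes its type. *)
Definition vn_dim (V : set tuple_fun) : R :=
  complex.Re (\sum_(i < n) inner (orth_proj V (unit_vec i)) (unit_vec i)).

(** Right multiplication by [A]: as (delta_u) h = delta_{u h}, the function
    x h takes at g the value of x at g h^-1. *)
Definition right_mul (A : 'M[group_ring G]_n) (x : tuple_fun) : tuple_fun :=
  fun j g => \sum_(i < n) \sum_(h <- finsupp (A i j))
    (A i j h)%:~R * x i (g * h^-1)%g.

Definition b2 (A : 'M[group_ring G]_n) : R :=
  vn_dim [set x | l2 x /\ right_mul A x = (fun _ _ => 0)].

End L2.

(* Main.v *)
Require Import Defs.
From HB Require Import structures.
From mathcomp Require Import all_boot all_order all_algebra finmap.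
From mathcomp Require Import all_fingroup gproduct algC spectral complex.
From mathcomp Require Import all_classical all_reals all_analysis.
From mathcomp Require summability.
From mathcomp Require Import ring lra zify.
From Stdlib Require Arith.Cantor.

Set Implicit Arguments.
Unset Strict Implicit.
Unset Printing Implicit Defensive.
Import Order.TTheory GRing.Theory Num.Theory.
Import numFieldNormedType.Exports.

(** Write A for the given self-adjoint matrix, L for the sum of the absolute
    values of all the coefficients of its representative, and C = 2^c >= L^2.
    As L bounds the norm of A, the operator T = 1 - A^2/C satisfies 0 <= T <= 1,
    its powers converge strongly to the projection onto ker A, and the numbers
    a_k = sum_i <T^k e_i, e_i> decrease to b2(A). Each a_k is rational: expand
    (C - A^2)^k formally, add up the coefficients of the diagonal words that
    represent 1 in G, and divide by C^k. Two things make this an algorithm: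
    deciding which words represent 1, and knowing how large k must be.

    Words. In a finitely presented group the words representing 1 can be
    enumerated by inserting and deleting relators ([derived_complete]). If the
    group is also residually finite, finitely many words representing
    nontrivial elements are all moved by one finite action of the generators
    that respects the relators ([fixes_complete]). An unbounded search for a
    certificate made of a derivation and an action therefore stops on the
    finitely many words of any one expansion, and whatever certificate it finds
    is right ([check_complete], [check_sound]).

    Speed of convergence. Choose a finite quotient H of G in which no two of the
    finitely many group elements in play become equal. There A becomes a
    symmetric integer matrix of size N = n|H|, with eigenvalues d in [-L, L],
    and |H| a_k is the trace of the corresponding power of T. Up to sign, the
    product of the nonzero eigenvalues is a coefficient of the characteristic
    polynomial, hence a nonzero integer; so at most cN/e of them satisfy
    0 < d^2 < 2^-e ([card_small_eigenvalues]). For k = e 2^(e+c) the other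
    nonzero eigenvalues contribute at most 1/(1+e) each, whence
    a_k - a_k' <= n(c+1)/e for every k' >= k ([gap_moment_rate]). The bound does
    not mention H, so it passes to the limit k' -> oo. This is Lueck's
    approximation argument.

    The limit. Operator theory on l2(G) is avoided: the facts about the
    vectors T^k e_i that are used (a_k decreases, the sequence is Cauchy, its
    norms are at most 1, A T^k e_i tends to 0) are inequalities between integers
    that concern finitely many group elements, and each is read off in a finite
    quotient, where it follows from the spectral theorem or from the symmetry
    of the matrix. The pointwise limit p_i of T^k e_i is then square-summable
    and killed by A; since A is self-adjoint, <T^k e_i, y> = <e_i, y> for every y
    in ker A, and bounded pointwise convergence is weak convergence, so p_i is
    the orthogonal projection of e_i ([proj_weak], [ker_orth_proj]) and
    b2(A) = sum_i p_i(i, 1) = lim a_k ([sum_moment_cvg]).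

    Programs. A class of functions between types with a numerical code is
    shown to be closed under the usual constructions on numbers, pairs and
    lists; the computation above is written in that class. The program demanded
    for a given input is the universal one with the input stored in it as a
    constant, and its code depends computably on the input
    ([computable_spec]). *)

(** * Computable functions on coded data *)
Class Enc (T : Type) := enc : T -> nat.
#[global] Instance enc_nat_inst : Enc nat := id.
#[global] Instance enc_bool_inst : Enc bool := nat_of_bool.
#[global] Instance enc_prod_inst (A B : Type) (eA : Enc A) (eB : Enc B) : Enc (A * B) :=
  fun p => enc_pair (enc p.1) (enc p.2).
#[global] Instance enc_list_inst (A : Type) (eA : Enc A) : Enc (seq A) :=
  fun s => enc_seq [seq enc a | a <- s].

(** Only values at codes of elements of A are constrained, so a program is free
    on numbers that code nothing. *)
Definition computable (A B : Type) {eA : Enc A} {eB : Enc B} (f : A -> B) : Prop :=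
  exists p, forall x, run p (enc x) (enc (f x)).

Lemma of_enc_pair a b : Cantor.of_nat (enc_pair a b) = (a, b).
Proof. exact: Cantor.cancel_of_to. Qed.

Lemma enc_pair_of c : enc_pair (Cantor.of_nat c).1 (Cantor.of_nat c).2 = c.
Proof. by rewrite /enc_pair -surjective_pairing Cantor.cancel_to_of. Qed.

Lemma leq_enc_pair a b : (a + b <= enc_pair a b)%N.
Proof. by apply/ssrnat.leP; rewrite addnC; apply: Cantor.to_nat_non_decreasing. Qed.

Section BasicPrograms.
Context {X A B C : Type} {eX : Enc X} {eA : Enc A} {eB : Enc B} {eC : Enc C}.

Lemma computable_ext (f g : A -> B) : f =1 g -> computable g -> computable f.
Proof. by move=> fg [p hp]; exists p => x; rewrite fg. Qed.

Fixpoint const_prog (k : nat) : prog :=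
  if k is k'.+1 then Comp Succ (const_prog k') else Zero.

Lemma run_const k x : run (const_prog k) x k.
Proof. by elim: k => //= k IH; exists k. Qed.

Lemma computable_const (b : B) : computable (fun _ : A => b).
Proof. by exists (const_prog (enc b)) => x; apply: run_const. Qed.

Definition id_prog := Pair Fst Snd.

Lemma run_id x : run id_prog x x.
Proof. by do 2!eexists; split=> //; rewrite -[LHS]enc_pair_of. Qed.

Lemma computable_id : computable (fun x : A => x).
Proof. by exists id_prog => x; apply: run_id. Qed.

Lemma computable_comp (g : B -> C) (f : A -> B) :
  computable g -> computable f -> computable (fun x => g (f x)).
Proof. by case=> p hp [q hq]; exists (Comp p q) => x; exists (enc (f x)). Qed.

Lemma computable_pair (f : A -> B) (g : A -> C) :
  computable f -> computable g -> computable (fun x => (f x, g x)).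
Proof.
case=> p hp [q hq]; exists (Pair p q) => x.
by exists (enc (f x)), (enc (g x)); split.
Qed.

Lemma computable_fst (f : A -> B * C) : computable f -> computable (fun x => (f x).1).
Proof.
case=> p hp; exists (Comp Fst p) => x; exists (enc (f x)) => //=.
by rewrite [enc (f x)]/(enc_pair _ _) of_enc_pair.
Qed.

Lemma computable_snd (f : A -> B * C) : computable f -> computable (fun x => (f x).2).
Proof.
case=> p hp; exists (Comp Snd p) => x; exists (enc (f x)) => //=.
by rewrite [enc (f x)]/(enc_pair _ _) of_enc_pair.
Qed.

Lemma computable_succ (f : A -> nat) : computable f -> computable (fun x => (f x).+1).
Proof. by case=> p hp; exists (Comp Succ p) => x; exists (enc (f x)). Qed.

(** A function into a coded type and the code of its value are computed by the
    same program; this permits passing from data to numbers. *)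
Lemma computable_code (f : A -> B) : computable f -> computable (fun x => enc (f x)).
Proof. by []. Qed.

(** Primitive recursion specialized to iteration; the loops over lists and
    numbers below are instances of it. *)
Lemma computable_iter (n : A -> nat) (f0 : A -> B) (F : A -> B -> B) :
  computable n -> computable f0 -> computable (fun t => F t.1 t.2) ->
  computable (fun x => iter (n x) (F x) (f0 x)).
Proof.
case=> pn hn [p0 h0] [pF hF].
pose step := Comp pF (Pair Fst (Comp Snd Snd)).
exists (Comp (Prec p0 step) (Pair id_prog pn)) => x /=.
exists (enc_pair (enc x) (n x)).
  by exists (enc x), (n x); split=> //; apply: run_id.
rewrite of_enc_pair /=; elim: (n x) => [|k IH] /=; first exact: h0.
exists (enc (iter k (F x) (f0 x))) => //.
exists (enc_pair (enc x) (enc (iter k (F x) (f0 x)))); last exact: (hF (x, _)).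
exists (enc x), (enc (iter k (F x) (f0 x))); rewrite -!/(enc_pair _ _).
split=> //=; first by rewrite of_enc_pair.
by exists (enc_pair k (enc (iter k (F x) (f0 x)))); rewrite ?of_enc_pair.
Qed.

Lemma computable_pred (f : A -> nat) : computable f -> computable (fun x => (f x).-1).
Proof.
case=> p hp.
exists (Comp (Prec Zero (Comp Fst Snd)) (Pair Zero p)) => x /=.
exists (enc_pair 0 (f x)); first by exists 0, (f x); split=> //; apply: hp.
rewrite of_enc_pair /=; case: (f x) => [|k] //=.
have [u hu] : exists u, prec_graph (fun _ v => v = 0)
     (fun x v => exists2 u, u = (Cantor.of_nat x).2 & v = (Cantor.of_nat u).1) 0 k u.
  elim: k => [|k [u hu]] /=; first by exists 0.
  by eexists; exists u => //; eexists; reflexivity.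
exists u => //; eexists; first by reflexivity.
by rewrite -!/(enc_pair _ _) !of_enc_pair.
Qed.

(** The test is used as the recursion variable of [Prec], so the program g is
    run only when the test succeeds and need not halt otherwise. This matters for
    list matching, where the head of an empty list has no code. *)
Lemma computable_cases (b : A -> bool) (f h : A -> B) (g : prog) :
  computable b -> computable f ->
  (forall x, b x -> run g (enc x) (enc (h x))) -> (forall x, ~~ b x -> h x = f x) ->
  computable h.
Proof.
case=> pb hb [pf hf] hg hh.
exists (Comp (Prec pf (Comp g Fst)) (Pair id_prog pb)) => x /=.
exists (enc_pair (enc x) (enc (b x))).
  by exists (enc x), (enc (b x)); split=> //; apply: run_id.
rewrite of_enc_pair /=; rewrite /enc /enc_bool_inst -/(enc x) -/(enc (h x)).
case bx: (b x) => /=; last by rewrite hh ?bx //; apply: hf.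
exists (enc (f x)); first exact: hf.
by exists (enc x); [rewrite -!/(enc_pair _ _) of_enc_pair | apply: hg].
Qed.

Lemma computable_if (b : A -> bool) (f g : A -> B) :
  computable b -> computable f -> computable g ->
  computable (fun x => if b x then g x else f x).
Proof.
move=> hb hf [pg hg]; apply: (computable_cases (g := pg) hb hf) => x; first by move=> ->.
by move/negbTE=> ->.
Qed.

End BasicPrograms.

Section ListMatching.
Context {X A B : Type} {eX : Enc X} {eA : Enc A} {eB : Enc B}.

Lemma computable_nonempty (l : X -> seq A) : computable l -> computable (fun x => ~~ nilp (l x)).
Proof.
move=> hl.
have sg : computable (fun x : X => iter (enc (l x)) (fun _ => true) false).
  apply: computable_iter; [exact: hl | exact: computable_const | exact: computable_const].
apply: (computable_ext _ sg) => x; rewrite [enc (l x)]/(enc_seq _).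
by case: (l x) => [|a r].
Qed.

Lemma computable_match (l : X -> seq A) (f : X -> B) (g : X -> A -> seq A -> B) :
  computable l -> computable f -> computable (fun t => g t.1.1 t.1.2 t.2) ->
  computable (fun x => if l x is a :: r then g x a r else f x).
Proof.
move=> hl hf [pg hg].
have [pu hu] : computable (fun x => (enc (l x)).-1) by apply: computable_pred; exact: hl.
apply: (computable_cases (b := fun x => ~~ nilp (l x)) (f := f)
  (g := Comp pg (Pair (Pair id_prog (Comp Fst pu)) (Comp Snd pu)))) => //.
- exact: computable_nonempty.
- move=> x; have := hu x; rewrite [enc (l x)]/(enc_seq _).
  case: (l x) => [|a r] //= hx _.
  exists (enc (x, a, r)); last exact: (hg (x, a, r)).
  exists (enc (x, a)), (enc r); split=> //.
    exists (enc x), (enc a); split=> //; first exact: run_id.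
    by eexists; first exact: hx; rewrite of_enc_pair.
  by eexists; first exact: hx; rewrite of_enc_pair.
- by move=> x; case: (l x).
Qed.

End ListMatching.

Section LeftFold.
Context {X A B C : Type} {eX : Enc X} {eA : Enc A} {eB : Enc B} {eC : Enc C}.

Lemma enc_cons (a : A) (s : seq A) : enc (a :: s) = (enc_pair (enc a) (enc s)).+1.
Proof. by []. Qed.

Lemma size_le_enc (s : seq A) : (size s <= enc s)%N.
Proof.
elim: s => //= a s IH; rewrite enc_cons ltnS.
exact: leq_trans (leq_trans IH (leq_addl _ _)) (leq_enc_pair _ _).
Qed.

Lemma computable_cons (f : X -> A) (l : X -> seq A) :
  computable f -> computable l -> computable (fun x => f x :: l x).
Proof. by move=> hf hl; apply: (computable_succ (f := fun x => enc (f x, l x))); apply: computable_pair. Qed.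

(** A loop over a list needs a number of rounds known in advance: the code of the
    list bounds its length ([size_le_enc]), and the superfluous rounds do
    nothing. *)
Lemma computable_foldl (F : X -> B -> A -> B) (z : X -> B) (l : X -> seq A) :
  computable (fun t => F t.1.1 t.1.2 t.2) -> computable z -> computable l ->
  computable (fun x => foldl (F x) (z x) (l x)).
Proof.
move=> hF hz hl.
pose stp x (p : B * seq A) := if p.2 is a :: r then (F x p.1 a, r) else p.
have key x b s n : (size s <= n)%N -> (iter n (stp x) (b, s)).1 = foldl (F x) b s.
  elim: n b s => [|n IH] b [|a s] //=; last by move=> h; rewrite -iterS iterSr /= IH.
  by move=> _; rewrite -iterS iterSr /= IH.
have h : computable (fun x => (iter (enc (l x)) (stp x) (z x, l x)).1); last first.
  by apply: (computable_ext _ h) => x; rewrite key ?size_le_enc.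
apply: computable_fst; apply: computable_iter; [exact: hl | exact: computable_pair |].
apply: computable_match; first by do 2!apply: computable_snd; exact: computable_id.
  by apply: computable_snd; apply: computable_id.
apply: computable_pair; last by apply: computable_snd; apply: computable_id.
apply: (computable_comp (g := fun t => F t.1.1 t.1.2 t.2) hF (f := fun x => (x.1.1.1, x.1.1.2.1, x.1.2))).
repeat apply: computable_pair.
- by do 3! apply: computable_fst; exact: computable_id.
- by apply: computable_fst; apply: computable_snd; do 2! apply: computable_fst; exact: computable_id.
- by apply: computable_snd; apply: computable_fst; exact: computable_id.
Qed.

End LeftFold.

Section ReversalAndRightFold.
Context {X A B C : Type} {eX : Enc X} {eA : Enc A} {eB : Enc B} {eC : Enc C}.

Lemma computable_rev (l : X -> seq A) : computable l -> computable (fun x => rev (l x)).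
Proof.
move=> hl; have h : computable (fun x => foldl (fun r a => a :: r) [::] (l x)).
  apply: computable_foldl => //; last exact: computable_const.
  by apply: computable_cons; [apply: computable_snd | apply: computable_snd; apply: computable_fst]; exact: computable_id.
apply: (computable_ext _ h) => x; rewrite /rev.
by elim: (l x) [::] => //= a s IH r.
Qed.

Lemma computable_foldr (F : X -> A -> B -> B) (z : X -> B) (l : X -> seq A) :
  computable (fun t => F t.1.1 t.1.2 t.2) -> computable z -> computable l ->
  computable (fun x => foldr (F x) (z x) (l x)).
Proof.
move=> hF hz hl.
have h : computable (fun x => foldl (fun b a => F x a b) (z x) (rev (l x))).
  apply: computable_foldl => //; last exact: computable_rev.
  apply: (computable_comp (g := fun t => F t.1.1 t.1.2 t.2) hF (f := fun x => (x.1.1, x.2, x.1.2))).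
  repeat apply: computable_pair.
  - by do 2! apply: computable_fst; exact: computable_id.
  - by apply: computable_snd; exact: computable_id.
  - by apply: computable_snd; apply: computable_fst; exact: computable_id.
by apply: (computable_ext _ h) => x; rewrite foldl_rev.
Qed.

End ReversalAndRightFold.

Section Concatenation.
Context {X A B C : Type} {eX : Enc X} {eA : Enc A} {eB : Enc B} {eC : Enc C}.

Lemma computable_cat (l1 l2 : X -> seq A) :
  computable l1 -> computable l2 -> computable (fun x => l1 x ++ l2 x).
Proof.
move=> h1 h2; have h : computable (fun x => foldr (fun a r => a :: r) (l2 x) (l1 x)).
  apply: computable_foldr => //.
  by apply: computable_cons; [apply: computable_snd; apply: computable_fst | apply: computable_snd]; exact: computable_id.
by apply: (computable_ext _ h) => x; elim: (l1 x) => //= a s ->.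
Qed.

End Concatenation.

Section ListOperations.
Context {X A B C : Type} {eX : Enc X} {eA : Enc A} {eB : Enc B} {eC : Enc C}.

Lemma computable_map (F : X -> A -> B) (l : X -> seq A) :
  computable (fun t => F t.1 t.2) -> computable l ->
  computable (fun x => [seq F x a | a <- l x]).
Proof.
move=> hF hl; have h : computable (fun x => foldr (fun a r => F x a :: r) [::] (l x)).
  apply: computable_foldr => //; last exact: computable_const.
  apply: computable_cons; last by apply: computable_snd; exact: computable_id.
  by apply: (computable_comp (g := fun t => F t.1 t.2) hF (f := fun x => x.1)); apply: computable_fst; exact: computable_id.
by apply: (computable_ext _ h) => x; elim: (l x) => //= a s ->.
Qed.

Lemma computable_flatten (l : X -> seq (seq A)) : computable l -> computable (fun x => flatten (l x)).
Proof.
move=> hl; rewrite /flatten; apply: (computable_foldr (F := fun _ => cat) (z := fun _ => [::])) => //.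
  2: by exact: computable_const.
by apply: computable_cat; [apply: computable_snd; apply: computable_fst | apply: computable_snd]; exact: computable_id.
Qed.

Lemma computable_has (p : X -> A -> bool) (l : X -> seq A) :
  computable (fun t => p t.1 t.2) -> computable l ->
  computable (fun x => has (p x) (l x)).
Proof.
move=> hp hl; have h : computable (fun x => foldr (fun a r => if p x a then true else r) false (l x)).
  apply: computable_foldr => //; last exact: computable_const.
  apply: computable_if; last exact: computable_const; last by apply: computable_snd; exact: computable_id.
  by apply: (computable_comp (g := fun t => p t.1 t.2) hp (f := fun x => x.1)); apply: computable_fst; exact: computable_id.
by apply: (computable_ext _ h) => x; elim: (l x) => //= a s ->.
Qed.

Lemma computable_all (p : X -> A -> bool) (l : X -> seq A) :
  computable (fun t => p t.1 t.2) -> computable l ->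
  computable (fun x => all (p x) (l x)).
Proof.
move=> hp hl; have h : computable (fun x => foldr (fun a r => if p x a then r else false) true (l x)).
  apply: computable_foldr => //; last exact: computable_const.
  apply: computable_if; first 1 last; [exact: computable_const | by apply: computable_snd; exact: computable_id |].
  by apply: (computable_comp (g := fun t => p t.1 t.2) hp (f := fun x => x.1)); apply: computable_fst; exact: computable_id.
by apply: (computable_ext _ h) => x; elim: (l x) => //= a s ->.
Qed.

Lemma computable_nth (d : A) (l : X -> seq A) (i : X -> nat) :
  computable l -> computable i -> computable (fun x => nth d (l x) (i x)).
Proof.
move=> hl hi; have h : computable (fun x => head d (iter (i x) behead (l x))).
  apply: (computable_match (f := fun _ => d) (g := fun _ a _ => a)); last 2 first.
  - exact: computable_const.
  - by apply: computable_snd; apply: computable_fst; exact: computable_id.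
  apply: computable_iter => //.
  apply: (computable_match (f := fun _ => [::]) (g := fun _ _ a => a)); last 2 first.
  - exact: computable_const.
  - by apply: computable_snd; exact: computable_id.
  by apply: computable_snd; exact: computable_id.
apply: (computable_ext _ h) => x; elim: (i x) (l x) => [|n IH] [|a s] //; rewrite iterSr //=.
  by rewrite -[RHS]IH; case: (n).
Qed.

Lemma computable_iota (n : X -> nat) : computable n -> computable (fun x => iota 0 (n x)).
Proof.
move=> hn; have h : computable (fun x => (iter (n x) (fun s => (s.1.+1, rcons s.2 s.1)) (0, [::])).2).
  apply: computable_snd; apply: computable_iter => //; first exact: computable_const.
  apply: computable_pair.
    by apply: computable_succ; apply: computable_fst; apply: computable_snd; exact: computable_id.
  apply: (computable_ext (g := fun t => t.2.2 ++ [:: t.2.1])); first by move=> t; rewrite cats1.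
  apply: computable_cat; first by do 2!apply: computable_snd; exact: computable_id.
  apply: computable_cons; last exact: computable_const.
  by apply: computable_fst; apply: computable_snd; exact: computable_id.
apply: (computable_ext _ h) => x.
suff -> : iter (n x) (fun s : nat * seq nat => (s.1.+1, rcons s.2 s.1)) (0, [::]) = (n x, iota 0 (n x)) by [].
by elim: (n x) => // k IH; rewrite iterS IH -[in RHS]addn1 iotaD cats1 addn1.
Qed.

End ListOperations.

Section Arithmetic.
Context {X A : Type} {eX : Enc X} {eA : Enc A}.
Implicit Types f g : X -> nat.

Lemma computable_add f g : computable f -> computable g -> computable (fun x => f x + g x).
Proof.
move=> hf hg; have h : computable (fun x => iter (f x) succn (g x)).
  by apply: computable_iter => //; apply: computable_succ; apply: computable_snd; exact: computable_id.
by apply: (computable_ext _ h) => x; elim: (f x) => //= k <-; rewrite addSn.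
Qed.

Lemma computable_sub f g : computable f -> computable g -> computable (fun x => f x - g x).
Proof.
move=> hf hg; have h : computable (fun x => iter (g x) predn (f x)).
  by apply: computable_iter => //; apply: computable_pred; apply: computable_snd; exact: computable_id.
by apply: (computable_ext _ h) => x; elim: (g x) => [|k /= <-]; [rewrite subn0 | rewrite subnS].
Qed.

End Arithmetic.

Section ProductsAndTests.
Context {X A : Type} {eX : Enc X} {eA : Enc A}.
Implicit Types f g : X -> nat.

Lemma computable_mul f g : computable f -> computable g -> computable (fun x => f x * g x).
Proof.
move=> hf hg; have h : computable (fun x => iter (f x) (fun s => g x + s) 0).
  apply: computable_iter => //; first exact: computable_const.
  apply: computable_add; last by apply: computable_snd; exact: computable_id.
  by apply: computable_comp => //; apply: computable_fst; exact: computable_id.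
by apply: (computable_ext _ h) => x; elim: (f x) => //= k <-; rewrite mulSn.
Qed.

Lemma computable_eqn f g : computable f -> computable g -> computable (fun x => f x == g x).
Proof.
move=> hf hg.
have h : computable (fun x => iter ((f x - g x) + (g x - f x)) (fun _ => false) true).
  apply: computable_iter; [|exact: computable_const|exact: computable_const].
  by apply: computable_add; apply: computable_sub.
apply: (computable_ext _ h) => x; set k := (_ + _)%N.
have -> : (f x == g x) = (k == 0) by rewrite /k; lia.
by case: k.
Qed.

Lemma computable_and (b c : X -> bool) : computable b -> computable c ->
  computable (fun x => b x && c x).
Proof.
move=> hb hc; apply: (computable_ext (g := fun x => if b x then c x else false)); first by move=> x; case: (b x).
by apply: computable_if => //; exact: computable_const.
Qed.

Lemma computable_or (b c : X -> bool) : computable b -> computable c ->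
  computable (fun x => b x || c x).
Proof.
move=> hb hc; apply: (computable_ext (g := fun x => if b x then true else c x)); first by move=> x; case: (b x).
by apply: computable_if => //; exact: computable_const.
Qed.

Lemma computable_neg (b : X -> bool) : computable b -> computable (fun x => ~~ b x).
Proof.
move=> hb; apply: (computable_ext (g := fun x => if b x then false else true)); first by move=> x; case: (b x).
by apply: computable_if => //; exact: computable_const.
Qed.

End ProductsAndTests.

Section Exponentiation.
Context {X A : Type} {eX : Enc X} {eA : Enc A}.

Lemma computable_exp (f g : X -> nat) : computable f -> computable g -> computable (fun x => f x ^ g x).
Proof.
move=> hf hg; have h : computable (fun x => iter (g x) (fun s => f x * s) 1).
  apply: computable_iter => //; first exact: computable_const.
  apply: computable_mul; last by apply: computable_snd; exact: computable_id.
  by apply: computable_comp => //; apply: computable_fst; exact: computable_id.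
by apply: (computable_ext _ h) => x; elim: (g x) => //= k <-; rewrite expnS.
Qed.

End Exponentiation.

Class EncInj (T : Type) (e : Enc T) := enc_inj : injective (enc (T := T)).
#[global] Instance enc_inj_nat : EncInj enc_nat_inst.
Proof. by []. Qed.
#[global] Instance enc_inj_prod A B eA eB {iA : EncInj eA} {iB : EncInj eB} :
  EncInj (@enc_prod_inst A B eA eB).
Proof.
move=> [a b] [c d] /(congr1 Cantor.of_nat); rewrite !of_enc_pair /=.
by case=> h1 h2; rewrite (enc_inj h1) (enc_inj h2).
Qed.
#[global] Instance enc_inj_list A eA {iA : EncInj eA} : EncInj (@enc_list_inst A eA).
Proof.
move=> s t; rewrite /enc /enc_list_inst /=; elim: s t => [|a s IH] [|b t] //=.
move=> [] /(congr1 Cantor.of_nat); rewrite !of_enc_pair /=.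
by case=> h1 h2; rewrite (enc_inj h1) (IH _ h2).
Qed.

Lemma computable_eq {X : Type} {A : eqType} {eX : Enc X} {eA : Enc A} {iA : EncInj eA} (f g : X -> A) :
  computable f -> computable g -> computable (fun x => f x == g x).
Proof.
move=> hf hg; apply: (computable_ext (g := fun x => enc (f x) == enc (g x))).
  by move=> x; rewrite (inj_eq enc_inj).
exact: computable_eqn.
Qed.

(** Unbounded search runs its test on every number, so every number has to code a
    candidate. *)
Class EncSurj (T : Type) (e : Enc T) := enc_surj : forall c, exists t : T, enc t = c.
#[global] Instance enc_surj_nat : EncSurj enc_nat_inst.
Proof. by move=> c; exists c. Qed.
#[global] Instance enc_surj_prod A B eA eB {iA : EncSurj eA} {iB : EncSurj eB} :
  EncSurj (@enc_prod_inst A B eA eB).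
Proof.
move=> c; have [a ha] := @enc_surj A _ _ (Cantor.of_nat c).1.
have [b hb] := @enc_surj B _ _ (Cantor.of_nat c).2.
by exists (a, b); rewrite /enc /enc_prod_inst /= ha hb enc_pair_of.
Qed.
#[global] Instance enc_surj_list A eA {iA : EncSurj eA} : EncSurj (@enc_list_inst A eA).
Proof.
move=> c; elim/ltn_ind: c => -[|c] IH; first by exists [::].
have [a ha] := @enc_surj A _ _ (Cantor.of_nat c).1.
have [|s hs] := IH (Cantor.of_nat c).2.
  rewrite ltnS -{2}(enc_pair_of c).
  exact: leq_trans (leq_addl _ _) (leq_enc_pair _ _).
by exists (a :: s); rewrite enc_cons ha hs enc_pair_of.
Qed.

(** The candidates are tried in the order of their codes, and the test halts on
    each of them; of the witness found, only that it passes the test is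
    recorded. *)
Lemma computable_search {X W B : Type} {eX : Enc X} {eW : Enc W} {sW : EncSurj eW} {eB : Enc B}
   (chk : X -> W -> bool) (out : X -> W -> B) :
  computable (fun t => chk t.1 t.2) -> computable (fun t => out t.1 t.2) ->
  exists p, forall x, (exists w, chk x w) ->
    exists w, chk x w /\ run p (enc x) (enc (out x w)).
Proof.
move=> /computable_neg [pc hc] [po ho].
exists (Comp po (Pair id_prog (Mu pc))) => x [w0 hw0].
pose good c := `[< exists2 w, @enc W eW w = c & chk x w >].
have ex : exists c, good c by exists (enc w0); apply/asboolP; exists w0.
case: (ex_minnP ex) => v /asboolP[w hw chkw] vmin.
exists w; split=> //; exists (enc_pair (enc x) v); last by rewrite -hw; apply: (ho (x, w)).
exists (enc x), v; split=> //; first exact: run_id.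
split; first by rewrite -hw; have := hc (x, w); rewrite /= chkw.
move=> i iv; have [w' hw'] := enc_surj (T := W) i.
have := hc (x, w'); rewrite /= -hw'.
case h : (chk x w'); last by exists 0.
suff : (v <= i)%N by rewrite leqNgt iv.
by apply: vmin; apply/asboolP; exists w'.
Qed.

(** The s-m-n construction: the first component of the input of p is frozen to x. *)
Definition spec_prog (p : prog) (x : nat) := Comp p (Pair (const_prog x) id_prog).

Lemma run_spec p x k v : run p (enc_pair x k) v -> run (spec_prog p x) k v.
Proof.
move=> h; exists (enc_pair x k) => //.
by exists x, k; split=> //; [exact: run_const | exact: run_id].
Qed.

Lemma computable_spec (p : prog) : computable (fun x : nat => enc_prog (spec_prog p x)).
Proof.
have hc : computable (fun x : nat => enc_prog (const_prog x)).
  have h : computable (fun x : nat => iter x (fun c => enc (5, (enc (1, 0), c))) (enc (0, 0))).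
    apply: computable_iter; [exact: computable_id | exact: computable_const |].
    apply: computable_code; apply: computable_pair; first exact: computable_const.
    by apply: computable_pair; [exact: computable_const | apply: computable_snd; exact: computable_id].
  by apply: (computable_ext _ h); elim=> //= k ->.
apply: (computable_code (f := fun x => (5, (enc_prog p, (4, (enc_prog (const_prog x), enc_prog id_prog)))))).
by repeat (apply: computable_pair; first by [exact: computable_const | exact: hc]); exact: computable_const.
Qed.

(** * The algorithm *)
Definition rword := seq (nat * nat).
(** The pair (a, b) stands for the integer a - b, so that sums and products need no
    case distinction on signs; [dec_rat] uses the same convention. *)
Definition zdiff := (nat * nat)%type.

Definition zmul (x y : zdiff) : zdiff := (x.1 * y.1 + x.2 * y.2, x.1 * y.2 + x.2 * y.1).
Definition zopp (x : zdiff) : zdiff := (x.2, x.1).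
(** Conversion from the codes of [enc_int], where (0, k) is k and (1, k) is
    -(k + 1). *)
Definition zdiff_of_sign (x : nat * nat) : zdiff := if x.1 == 0 then (x.2, 0) else (0, x.2.+1).

(** A formal row vector: the list of its terms z e_i w, with z a coefficient,
    i < n a coordinate and w a word. *)
Definition fvec := seq (zdiff * (nat * rword)).
(** A formal matrix: its terms are z, a row, a column and a word. *)
Definition fmat := seq (zdiff * (nat * (nat * rword))).
Definition rows := seq (seq (seq ((nat * nat) * rword))).

Definition entries (n : nat) (r : rows) : fmat :=
  flatten [seq flatten [seq [seq (zdiff_of_sign t.1, (i, (j, t.2)))
    | t <- nth [::] (nth [::] r i) j] | j <- iota 0 n] | i <- iota 0 n].

Definition fmul (v : fvec) (es : fmat) : fvec :=
  flatten [seq flatten [seq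
    if e.2.1 == t.2.1 then [:: (zmul t.1 e.1, (e.2.2.1, t.2.2 ++ e.2.2.2))] else [::]
    | e <- es] | t <- v].

(** The vector v (C - A^2). *)
Definition fstep (C : nat) (es : fmat) (v : fvec) : fvec :=
  [seq (zmul (C, 0) t.1, t.2) | t <- v] ++
  [seq (zopp t.1, t.2) | t <- fmul (fmul v es) es].

Definition fpow (C : nat) (es : fmat) (m i : nat) : fvec :=
  iter m (fstep C es) [:: ((1, 0), (i, [::]))].

Definition ftrace (C : nat) (es : fmat) (m n : nat) : seq (zdiff * rword) :=
  flatten [seq flatten [seq if t.2.1 == i then [:: (t.1, t.2.2)] else [::]
    | t <- fpow C es m i] | i <- iota 0 n].

(** A finite action of the generators on numbers: the edge ((l, p), q) says that
    the letter l sends p to q; points without an edge are fixed. *)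
Definition edges := seq ((nat * nat) * nat * nat).

Definition hop (E : edges) (p : nat) (l : nat * nat) : nat :=
  foldr (fun e r => if e.1 == (l, p) then e.2 else r) p E.
Definition walk (E : edges) (p : nat) (w : rword) : nat := foldl (hop E) p w.
(** Sources of edges suffice: all other points are fixed by every letter. *)
Definition fixes (E : edges) (w : rword) : bool :=
  all (fun e => walk E e.1.2 w == e.1.2) E.

Definition trivial_words (m : nat) (rels : seq rword) : seq rword :=
  rels ++ flatten [seq [:: [:: (i, 0); (i, 1)]; [:: (i, 1); (i, 0)]] | i <- iota 0 m].

(** One instruction (u, r, v) of a derivation: if r is a defining trivial word,
    then uv and urv are equal in the group, so that either is trivial when the
    other is. *)
Definition derive_step (S : seq rword) (D : seq rword) (c : rword * rword * rword) :=
  if c.1.2 \in S then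
    (if c.1.1 ++ c.2 \in D then [:: c.1.1 ++ c.1.2 ++ c.2] else [::]) ++
    ((if c.1.1 ++ c.1.2 ++ c.2 \in D then [:: c.1.1 ++ c.2] else [::]) ++ D)
  else D.
Definition derived (S : seq rword) (cert : seq (rword * rword * rword)) : seq rword :=
  foldl (derive_step S) [:: [::]] cert.

Definition input := ((nat * seq rword) * (nat * rows))%type.
Definition certificate := (edges * seq (rword * rword * rword))%type.

(** The code of the input bounds the sum of the absolute values of all the
    coefficients, so that 2^(2 code) is at least the square of that sum. *)
Definition expo (x : input) : nat := 2 * enc x.
(** With this e and k = e 2^(e + c) the error bound n(c + 1)/e is at most
    2^-k0, where k0 is the precision asked for. *)
Definition cutoff (x : input) (k : nat) : nat := (expo x).+1 * x.2.1.+1 * 2 ^ k.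
Definition steps (x : input) (k : nat) : nat := cutoff x k * 2 ^ (cutoff x k + expo x).

Definition trace_terms (x : input) (k : nat) : seq (zdiff * rword) :=
  ftrace (2 ^ expo x) (entries x.2.1 x.2.2) (steps x k) x.2.1.

Definition check (xk : input * nat) (c : certificate) : bool :=
  let S := trivial_words xk.1.1.1 xk.1.1.2 in
  all (fixes c.1) S &&
  all (fun t => (t.2 \in derived S c.2) || ~~ fixes c.1 t.2) (trace_terms xk.1 xk.2).

Definition zsum (s : seq (zdiff * rword)) : zdiff :=
  foldr (fun t r => (t.1.1 + r.1, t.1.2 + r.2)) (0, 0) s.

Definition output (xk : input * nat) (c : certificate) : (nat * nat) * nat :=
  let D := derived (trivial_words xk.1.1.1 xk.1.1.2) c.2 in
  (zsum (flatten [seq if t.2 \in D then [:: t] else [::] | t <- trace_terms xk.1 xk.2]),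
   ((2 ^ expo xk.1) ^ steps xk.1 xk.2).-1).

Lemma computable_mem {X : Type} {A : eqType} {eX : Enc X} {eA : Enc A} {iA : EncInj eA}
    (f : X -> A) (l : X -> seq A) :
  computable f -> computable l -> computable (fun x => f x \in l x).
Proof.
move=> hf hl; apply: (computable_ext (g := fun x => has (fun a => a == f x) (l x))).
  by move=> x; rewrite -has_pred1.
apply: (computable_has (p := fun x a => a == f x)) => //.
apply: computable_eq; first by apply: computable_snd; exact: computable_id.
by apply: (computable_comp hf); apply: computable_fst; exact: computable_id.
Qed.

(** Computability of an expression is proved along its syntax. *)
Ltac computability_step :=
  lazymatch goal with
  | |- computable (@fst _ _) => exact: (computable_fst computable_id)
  | |- computable (@snd _ _) => exact: (computable_snd computable_id)
  | |- computable (fun x => fst (@?f x)) => apply: computable_fst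
  | |- computable (fun x => snd (@?f x)) => apply: computable_snd
  | |- computable (fun x => pair (@?f x) (@?g x)) => apply: computable_pair
  | |- computable (fun x => x) => exact: computable_id
  | |- computable (fun x => S (@?f x)) => apply: computable_succ
  | |- computable (fun x => predn (@?f x)) => apply: computable_pred
  | |- computable (fun x => addn (@?f x) (@?g x)) => apply: computable_add
  | |- computable (fun x => muln (@?f x) (@?g x)) => apply: computable_mul
  | |- computable (fun x => expn (@?f x) (@?g x)) => apply: computable_exp
  | |- computable (fun x => eq_op (@?f x) (@?g x)) => apply: computable_eq
  | |- computable (fun x => andb (@?f x) (@?g x)) => apply: computable_and
  | |- computable (fun x => orb (@?f x) (@?g x)) => apply: computable_or
  | |- computable (fun x => negb (@?f x)) => apply: computable_neg
  | |- computable (fun x => cons (@?f x) (@?g x)) => apply: computable_cons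
  | |- computable (fun x => cat (@?f x) (@?g x)) => apply: computable_cat
  | |- computable (fun x => flatten (@?f x)) => apply: computable_flatten
  | |- computable (fun x => map (@?f x) (@?g x)) => apply: computable_map
  | |- computable (fun x => all (@?f x) (@?g x)) => apply: computable_all
  | |- computable (fun x => has (@?f x) (@?g x)) => apply: computable_has
  | |- computable (fun x => nth _ (@?f x) (@?g x)) => apply: computable_nth
  | |- computable (fun x => iota 0 (@?g x)) => apply: computable_iota
  | |- computable (fun x => foldr (@?f x) (@?z x) (@?g x)) => apply: computable_foldr
  | |- computable (fun x => foldl (@?f x) (@?z x) (@?g x)) => apply: computable_foldl
  | |- computable (fun x => iter (@?n x) (@?f x) (@?g x)) => apply: computable_iter
  | |- computable (fun x => in_mem (@?n x) (mem (@?g x))) => apply: computable_mem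
  | |- computable (fun x => @enc _ _ (@?f x)) => apply: computable_code
  | |- _ => first [solve [exact: computable_const | eassumption] | apply: computable_if]
  end.
Ltac computability := repeat computability_step.

Section FormalVectors.
Context {X : Type} {eX : Enc X}.

Lemma computable_entries (n : X -> nat) (r : X -> rows) :
  computable n -> computable r -> computable (fun x => entries (n x) (r x)).
Proof.
move=> hn hr; have h : computable (fun t : nat * rows => entries t.1 t.2).
  by rewrite /entries /zdiff_of_sign; computability.
by apply: (computable_comp h (f := fun x => (n x, r x))); computability.
Qed.

Lemma computable_fmul (v : X -> fvec) (es : X -> fmat) :
  computable v -> computable es -> computable (fun x => fmul (v x) (es x)).
Proof.
move=> hv he; have h : computable (fun t : fvec * fmat => fmul t.1 t.2).
  by rewrite /fmul /zmul; computability.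
by apply: (computable_comp h (f := fun x => (v x, es x))); computability.
Qed.

End FormalVectors.

Section FormalIteration.
Context {X : Type} {eX : Enc X}.

Lemma computable_fstep (C : X -> nat) (es : X -> fmat) (v : X -> fvec) :
  computable C -> computable es -> computable v ->
  computable (fun x => fstep (C x) (es x) (v x)).
Proof.
move=> hC he hv; have h : computable (fun t : nat * fmat * fvec => fstep t.1.1 t.1.2 t.2).
  rewrite /fstep /zmul /zopp; computability.
  by apply: computable_fmul; computability; apply: computable_fmul; computability.
by apply: (computable_comp h (f := fun x => (C x, es x, v x))); computability.
Qed.

End FormalIteration.

Lemma computable_ftrace : computable (fun t : nat * fmat * nat * nat =>
  ftrace t.1.1.1 t.1.1.2 t.1.2 t.2).
Proof.
rewrite /ftrace /fpow; computability.
by apply: computable_fstep; computability.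
Qed.

Lemma computable_trace_terms : computable (fun xk => trace_terms xk.1 xk.2).
Proof.
apply: (computable_comp computable_ftrace (f := fun xk : input * nat =>
  (2 ^ expo xk.1, entries xk.1.2.1 xk.1.2.2, steps xk.1 xk.2, xk.1.2.1))).
rewrite /steps /cutoff /expo; computability.
by apply: computable_entries; computability.
Qed.

Lemma computable_trivial_words : computable (fun p => trivial_words p.1 p.2).
Proof. by rewrite /trivial_words; computability. Qed.

Lemma computable_derived : computable (fun p => derived p.1 p.2).
Proof. by rewrite /derived /derive_step; computability. Qed.

Lemma computable_derived_cert : computable (fun t : input * nat * certificate =>
  derived (trivial_words t.1.1.1.1 t.1.1.1.2) t.2.2).
Proof.
apply: (computable_comp computable_derived (f := fun t => (trivial_words _ _, _))); computability.
by apply: (computable_comp computable_trivial_words (f := fun t => (t.1.1.1.1, t.1.1.1.2))); computability.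
Qed.

Lemma computable_fixes : computable (fun p => fixes p.1 p.2).
Proof. by rewrite /fixes /walk /hop; computability. Qed.

Lemma computable_check : computable (fun t => check t.1 t.2).
Proof.
rewrite /check /=; computability.
- apply: (computable_comp computable_fixes (f := fun t => (_, _))); computability.
- apply: (computable_comp computable_trivial_words (f := fun t => (t.1.1.1.1, t.1.1.1.2))); computability.
- by apply: (computable_comp computable_derived_cert (f := fun t => t.1)); computability.
- apply: (computable_comp computable_fixes (f := fun t => (_, _))); computability.
- by apply: (computable_comp computable_trace_terms (f := fun t => t.1)); computability.
Qed.

Lemma computable_output : computable (fun t => output t.1 t.2).
Proof.
rewrite /output /zsum /=; computability.
- by apply: (computable_comp computable_derived_cert (f := fun t => t.1)); computability.
- by apply: (computable_comp computable_trace_terms (f := fun t => t.1)); computability.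
- by rewrite /expo; computability.
- by rewrite /steps /cutoff /expo; computability.
Qed.

Local Open Scope group_scope.
(** * Finite quotients and the word problem *)
Section GroupHom.
Variables (G H : groupType) (f : G -> H).
Hypothesis fM : {morph f : x y / x * y}.

Lemma morph1g : f 1 = 1.
Proof. by apply: (mulIg (f 1)); rewrite -fM !mul1g. Qed.

Lemma morphVg x : f x^-1 = (f x)^-1.
Proof. by apply: (mulIg (f x)); rewrite -fM !mulVg morph1g. Qed.
End GroupHom.

(** Finitely many elements are handled at once by the product of the finite
    quotients that detect them one by one. *)
Lemma residually_finite_separates (G : groupType) (gs : seq G) :
  residually_finite G -> (forall g, g \in gs -> g != 1) ->
  exists (H : finGroupType) (f : G -> H),
    {morph f : x y / x * y} /\ forall g, g \in gs -> f g != 1.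
Proof.
move=> rf; elim: gs => [|g gs IH] hgs.
  exists ('S_1 : finGroupType), (fun=> 1); split=> // x y; by rewrite mulg1.
have [|H1 [f1 [f1M hf1]]] := IH; first by move=> h hh; apply: hgs; rewrite inE hh orbT.
have [|H2 [f2 hf2]] := rf g; first by apply: hgs; rewrite inE eqxx.
exists (H2 * H1)%type, (fun x => (f2 x, f1 x)); split=> [x y|h].
  by rewrite gmulfM f1M.
rewrite inE => /orP[/eqP->|/hf1 hh]; apply/eqP => /=.
  by move/(congr1 fst) => /= /eqP; apply/negP.
by move/(congr1 snd) => /= /eqP; apply/negP.
Qed.

(** Values of untyped words: letters are pairs of numbers, the second one being 0
    for a generator and nonzero for an inverse. *)
Definition rletter_val (K : groupType) (t : nat -> K) (l : nat * nat) : K :=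
  if l.2 == 0%N then t l.1 else (t l.1)^-1.
Definition rval (K : groupType) (t : nat -> K) (w : rword) : K :=
  \prod_(l <- w) rletter_val t l.

Section RawValue.
Variables (K : groupType) (t : nat -> K).

Lemma rval_nil : rval t [::] = 1.
Proof. exact: big_nil. Qed.

Lemma rval_cons l w : rval t (l :: w) = rletter_val t l * rval t w.
Proof. exact: big_cons. Qed.

Lemma rval_cat u v : rval t (u ++ v) = rval t u * rval t v.
Proof. exact: big_cat. Qed.

End RawValue.

Lemma morph_rval (G H : groupType) (f : G -> H) (t : nat -> G) w :
  {morph f : x y / x * y} -> f (rval t w) = rval (f \o t) w.
Proof.
move=> fM; elim: w => [|l w IH]; first by rewrite !rval_nil morph1g.
rewrite !rval_cons fM IH; congr (_ * _).
by rewrite /rletter_val; case: ifP => // _; rewrite morphVg.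
Qed.

Definition raw_word (m : nat) (w : word m) : rword :=
  [seq (nat_of_ord l.1, nat_of_bool l.2) | l <- w].

(** Numbers that name no generator are sent to 1; thereby soundness of
    derivations holds for arbitrary untyped words. *)
Definition gen_val (m : nat) (G : groupType) (s : 'I_m -> G) (i : nat) : G :=
  if insub i is Some i' then s i' else 1.

Lemma rval_raw (m : nat) (G : groupType) (s : 'I_m -> G) (w : word m) :
  rval (gen_val s) (raw_word w) = word_val s w.
Proof.
rewrite /rval /word_val big_map; apply: eq_bigr => -[i b] _.
by rewrite /rletter_val /letter_val /gen_val /= valK; case: b.
Qed.

Lemma raw_cat m (u v : word m) : raw_word (u ++ v) = raw_word u ++ raw_word v.
Proof. exact: map_cat. Qed.

Section Certificates.
Variables (P : presentation) (G : groupType) (s : 'I_(ngen P) -> G).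
Hypothesis pres : presents s.

Local Notation m := (ngen P).
Definition raw_rels := [seq raw_word r | r <- relators P].
Local Notation S := (trivial_words m raw_rels).
Local Notation val := (rval (gen_val s)).

Lemma mem_cancel (i : 'I_m) (b : bool) : raw_word [:: (i, b); (i, ~~ b)] \in S.
Proof.
rewrite mem_cat; apply/orP; right; apply/flattenP.
exists [:: [:: (nat_of_ord i, 0); (nat_of_ord i, 1)]; [:: (nat_of_ord i, 1); (nat_of_ord i, 0)]]%N.
  by apply: (map_f (fun i => [:: [:: (i, 0); (i, 1)]; [:: (i, 1); (i, 0)]]%N));
    rewrite mem_iota /=.
by case: b; rewrite /raw_word /= !inE eqxx ?orbT.
Qed.

Lemma mem_rel r : r \in relators P -> raw_word r \in S.
Proof. by move=> hr; rewrite mem_cat map_f. Qed.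

Lemma trivial_words_sound w : w \in S -> val w = 1.
Proof.
rewrite mem_cat => /orP[/mapP[r hr ->]|/flattenP[l /mapP[i _ ->]]].
  by rewrite rval_raw; have /pres.2 -> := pres_rel hr; rewrite /word_val big_nil.
rewrite !inE => /orP[]/eqP->; rewrite !rval_cons rval_nil mulg1 /rletter_val /=.
  exact: mulgV.
exact: mulVg.
Qed.

Lemma derived_sound cert w : w \in derived S cert -> val w = 1.
Proof.
rewrite /derived; have : forall w, w \in [:: [::]] -> val w = 1.
  by move=> w0; rewrite inE => /eqP->; rewrite rval_nil.
move: [:: [::]] => D; elim: cert D => [|c cert IH] D hD //=; first exact: hD.
apply: IH => {}w; rewrite /derive_step; case: ifP => [/trivial_words_sound hc|_]; last exact: hD.
rewrite !mem_cat => /or3P[||]; last exact: hD.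
  case: ifP => // /hD; rewrite inE rval_cat => h /eqP->.
  by rewrite !rval_cat hc mul1g.
case: ifP => // /hD; rewrite inE !rval_cat hc mul1g => h /eqP->.
by rewrite rval_cat.
Qed.

(** Derivations act on a whole list D of words known to be trivial, so that they
    can be concatenated, and adding words to D does no harm. *)
Definition derives u v := exists cert, forall D : seq rword,
  u \in D -> v \in foldl (derive_step S) D cert.

Lemma derive_step_sub D c : {subset D <= derive_step S D c}.
Proof. by move=> w hw; rewrite /derive_step; case: ifP => // _; rewrite !mem_cat hw !orbT. Qed.

Lemma derived_sub D cert : {subset D <= foldl (derive_step S) D cert}.
Proof. by elim: cert D => [|c cert IH] D w hw //=; apply/IH/derive_step_sub. Qed.

Lemma derives_refl u : derives u u.
Proof. by exists [::]. Qed.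

Lemma derives_trans v u w : derives u v -> derives v w -> derives u w.
Proof. by case=> c1 h1 [c2 h2]; exists (c1 ++ c2) => D /h1/h2; rewrite foldl_cat. Qed.

Lemma derives_insert u r v : r \in S -> derives (u ++ v) (u ++ r ++ v).
Proof.
move=> hr; exists [:: ((u, r), v)] => D hD /=.
by rewrite /derive_step /= hr !mem_cat hD inE eqxx.
Qed.

Lemma derives_delete u r v : r \in S -> derives (u ++ r ++ v) (u ++ v).
Proof.
move=> hr; exists [:: ((u, r), v)] => D hD /=.
by rewrite /derive_step /= hr !mem_cat hD inE eqxx orbT.
Qed.

(** The congruence is handled in an arbitrary context u, v because derivations
    act inside words; both directions are proved together because of the
    symmetry rule. *)
Lemma pres_derives w1 w2 : pres_eq (P := P) w1 w2 -> forall u v,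
  derives (u ++ raw_word w1 ++ v) (u ++ raw_word w2 ++ v) /\
  derives (u ++ raw_word w2 ++ v) (u ++ raw_word w1 ++ v).
Proof.
elim=> {w1 w2} [w|w1 w2 _ IH|w1 w2 w3 _ IH1 _ IH2|w1 w2 w3 w4 _ IH1 _ IH2|i b|r hr] u v.
- by split; apply: derives_refl.
- by have [] := IH u v.
- by have [? ?] := IH1 u v; have [? ?] := IH2 u v; split; apply: (derives_trans (v := u ++ raw_word w2 ++ v)).
- have [h1 h2] := IH1 u (raw_word w3 ++ v); have := IH2 (u ++ raw_word w2) v.
  rewrite -!catA => -[h3 h4]; rewrite !raw_cat -!catA.
  by split; apply: (derives_trans (v := u ++ raw_word w2 ++ raw_word w3 ++ v)).
- by split; [apply: derives_delete|apply: derives_insert]; apply: mem_cancel.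
- by split; [apply: derives_delete|apply: derives_insert]; apply: mem_rel.
Qed.

Lemma derived_complete (ws : seq (word m)) :
  exists cert, forall w, w \in ws -> word_val s w = 1 -> raw_word w \in derived S cert.
Proof.
elim: ws => [|w ws [cert IH]]; first by exists [::].
have [hw|/eqP hw] := eqVneq (word_val s w) 1; last first.
  by exists cert => w'; rewrite inE => /orP[/eqP->|/IH //].
have /pres.2/pres_derives/(_ [::] [::]) [_ [c hc]] : word_val s w = word_val s [::].
  by rewrite hw /word_val big_nil.
exists (cert ++ c) => w'; rewrite /derived foldl_cat inE => /orP[/eqP-> _|h1 h2].
  by rewrite -[raw_word w]cats0; apply: hc; apply: derived_sub; rewrite inE.
by apply: derived_sub; apply: IH.
Qed.

Lemma walk_cat E p u v : walk E p (u ++ v) = walk E (walk E p u) v.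
Proof. exact: foldl_cat. Qed.

Lemma hop_notin E p l : p \notin [seq e.1.2 | e <- E] -> hop E p l = p.
Proof.
elim: E => //= e E IH; rewrite inE negb_or => /andP[h1 /IH ->].
by case: ifP => // /eqP he; rewrite he eqxx in h1.
Qed.

Lemma walk_notin E p w : p \notin [seq e.1.2 | e <- E] -> walk E p w = p.
Proof. by move=> hp; elim: w => //= l w IH; rewrite /walk /= hop_notin. Qed.

Lemma fixesP E w : reflect (forall p, walk E p w = p) (fixes E w).
Proof.
apply: (iffP allP) => [h p|h e _]; last by rewrite h.
have [/mapP[e he ->]|hp] := boolP (p \in [seq e.1.2 | e <- E]).
  exact/eqP/h.
exact: walk_notin.
Qed.

(** An action respecting the defining trivial words factors through the group. *)
Lemma fixes_sound E w : all (fixes E) S -> word_val s w = 1 -> fixes E (raw_word w).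
Proof.
move=> /allP hE hw; apply/fixesP.
have /pres.2 : word_val s w = word_val s [::] by rewrite hw /word_val big_nil.
suff key w1 w2 : pres_eq (P := P) w1 w2 -> forall p, walk E p (raw_word w1) = walk E p (raw_word w2).
  by move/key => h p; rewrite h.
elim=> {w w1 w2 hw} // [w1 w2 w3 _ IH1 _ IH2|w1 w2 w3 w4 _ IH1 _ IH2|i b|r hr] p.
- by rewrite IH1.
- by rewrite !raw_cat !walk_cat IH1 IH2.
- exact/fixesP/hE/mem_cancel.
- exact/fixesP/hE/mem_rel.
Qed.

(** The action is right translation in a finite quotient, with its elements
    numbered. A word nontrivial in the quotient moves the number of 1. *)
Lemma fixes_complete (ws : seq (word m)) : residually_finite G ->
  exists E, all (fixes E) S /\
    forall w, w \in ws -> word_val s w != 1 -> ~~ fixes E (raw_word w).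
Proof.
move=> rf.
have [|H [f [fM hf]]] :=
  @residually_finite_separates G [seq x <- [seq word_val s w | w <- ws] | x != 1] rf.
  by move=> g; rewrite mem_filter => /andP[].
pose rk (h : H) : nat := enum_rank h.
have rk_inj : injective rk by move=> h h' /val_inj/enum_rank_inj.
pose tf : nat -> H := f \o gen_val s.
pose letters : seq (nat * nat) := flatten [seq [:: (i, 0); (i, 1)]%N | i <- iota 0 m].
(* One edge for each letter and each element of H: right translation. *)
pose E : edges := flatten [seq [seq (l, rk h, rk (h * rletter_val tf l)) | h <- enum H] | l <- letters].
have hopE l h : l \in letters -> hop E (rk h) l = rk (h * rletter_val tf l).
  have hE e : e \in E -> e.1 = (l, rk h) -> e.2 = rk (h * rletter_val tf l).
    by case/flattenP => _ /mapP[l' _ ->] /mapP[h' _ ->] /= [-> /rk_inj ->].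
  move=> hl.
  have : has (fun e => e.1 == (l, rk h)) E.
    apply/hasP; exists ((l, rk h), rk (h * rletter_val tf l)) => //=.
    apply/flattenP; exists [seq (l, rk h, rk (h * rletter_val tf l)) | h <- enum H].
      by apply/mapP; exists l.
    by apply/mapP; exists h; rewrite ?mem_enum.
  elim: (E) hE => //= e E' IH hE; case: ifP => [/eqP he _|he /= hh].
    by apply: hE => //; rewrite inE eqxx.
  by apply: IH => // e' h1; apply: hE; rewrite inE h1 orbT.
have walkE h w : all (mem letters) w -> walk E (rk h) w = rk (h * rval tf w).
  elim: w h => [|l w IH] h /=; first by rewrite rval_nil mulg1.
  by move=> /andP[hl hw]; rewrite /walk /= -/(walk _ _ _) hopE // IH // rval_cons mulgA.
have lettersP i b : ((i < m)%N -> (i, nat_of_bool b) \in letters).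
  move=> im; apply/flattenP; exists [:: (i, 0); (i, 1)]%N.
    by apply: (map_f (fun i => [:: (i, 0); (i, 1)]%N)); rewrite mem_iota.
  by case: b; rewrite !inE eqxx ?orbT.
have rawP (w : word m) : all (mem letters) (raw_word w).
  by apply/allP => _ /mapP[l _ ->]; apply: lettersP.
have SP w : w \in S -> all (mem letters) w.
  rewrite mem_cat => /orP[/mapP[r _ ->]|/flattenP[l /mapP[i hi ->]]]; first exact: rawP.
  rewrite mem_iota /= in hi.
  have := lettersP i false hi; have := lettersP i true hi.
  rewrite !inE => h1 h0 /orP[]/eqP->; apply/allP => y;
    by rewrite !inE => /orP[]/eqP->.
have srcE e : e \in E -> exists h, e.1.2 = rk h.
  by case/flattenP => _ /mapP[l' _ ->] /mapP[h' _ ->] /=; exists h'.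
exists E; split.
  apply/allP => w hw; apply/allP => e /srcE[h ->]; rewrite walkE ?SP //.
  by rewrite -morph_rval // trivial_words_sound // morph1g // mulg1.
move=> w hw w1; apply/fixesP => /(_ (rk 1)); rewrite walkE // => /rk_inj.
rewrite mul1g -morph_rval // rval_raw => /eqP; apply/negP; apply: hf.
by rewrite mem_filter w1 map_f.
Qed.

End Certificates.

Local Close Scope group_scope.
Local Open Scope ring_scope.
Local Open Scope sesquilinear_scope.
(** * Symmetric integer matrices *)
Lemma char_poly_conj (F : fieldType) n (P D : 'M[F]_n) : P \in unitmx ->
  char_poly (invmx P *m D *m P) = char_poly D.
Proof.
move=> Pu; rewrite /char_poly.
have -> : char_poly_mx (invmx P *m D *m P) =
   map_mx polyC (invmx P) *m char_poly_mx D *m map_mx polyC P.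
  rewrite /char_poly_mx mulmxBr mulmxBl -!map_mxM /=; congr (_ - _).
  by rewrite scalar_mxC -mulmxA -map_mxM /= mulVmx // map_mx1 mulmx1.
rewrite !det_mulmx mulrAC -det_mulmx -map_mxM /= mulVmx //.
by rewrite map_mx1 det1 mul1r.
Qed.

Section SymmetricIntegerMatrix.
Variables (N : nat) (A : 'M[int]_N) (L C : nat).
Hypothesis A_sym : A^T = A.
Hypothesis A_bound : forall j, \sum_i `|A i j| <= L%:Z.
Hypothesis LC : (L ^ 2 <= C)%N.
Hypothesis C_gt0 : (0 < C)%N.

(** The positive matrix C - A^2; its powers divided by those of C converge to
    the projection onto the kernel of A. *)
Definition gap_mx : 'M[int]_N := C%:R%:M - A *m A.

Let Ac : 'M[algC]_N := map_mx intr A.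
Let U := spectralmx Ac.
Let d i : algC := spectral_diag Ac 0 i.
Let z i := d i ^+ 2.

Lemma gap_pow_sym k : (gap_mx ^+ k)^T = gap_mx ^+ k.
Proof.
elim: k => [|k IH]; first by rewrite expr0 trmx1.
rewrite {1}exprS trmx_mul IH /gap_mx linearB /= tr_scalar_mx trmx_mul A_sym.
by rewrite -/gap_mx exprSr.
Qed.

Lemma sum_sqr_row (M : 'M[int]_N) x : \sum_y M x y ^+ 2 = (M *m M^T) x x.
Proof. by rewrite mxE; apply: eq_bigr => y _; rewrite mxE expr2. Qed.

(** A square of one entry is at most the squared norm of its row; the estimates on
    vectors below are all obtained in this way from diagonal entries. *)
Lemma sqr_entry_le (M : 'M[int]_N) x y : M x y ^+ 2 <= (M *m M^T) x x.
Proof.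
rewrite -sum_sqr_row (bigD1 y) //= lerDl sumr_ge0 // => i _.
exact: sqr_ge0.
Qed.

(** The right-hand side is the squared norm of row x of C^k W^m - C^m W^k, with
    W = C - A^2; in the normalization by powers of C it becomes small because the
    diagonal entries converge. *)
Lemma gap_pow_cauchy m k x y :
  (C%:R ^+ k * (gap_mx ^+ m) x y - C%:R ^+ m * (gap_mx ^+ k) x y) ^+ 2 <=
  C%:R ^+ (k + k) * (gap_mx ^+ (m + m)) x x
  - 2%:R * C%:R ^+ (m + k) * (gap_mx ^+ (m + k)) x x
  + C%:R ^+ (m + m) * (gap_mx ^+ (k + k)) x x.
Proof.
set W := gap_mx.
pose D := C%:R ^+ k *: W ^+ m - C%:R ^+ m *: W ^+ k.
have DT : D^T = D by rewrite /D linearB /= 2!linearZ /= !gap_pow_sym.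
have WW i j : W ^+ i *m W ^+ j = W ^+ (i + j) by rewrite exprD.
have := sqr_entry_le D x y; rewrite DT /D mulmxBr !mulmxBl -!scalemxAl -!scalemxAr !scalerA !WW.
rewrite (addnC k m) !mxE => /le_trans; apply.
rewrite le_eqVlt; apply/orP; left; apply/eqP; rewrite !exprD; ring.
Qed.

Lemma gap_pow_bessel m x (ys : seq 'I_N) : uniq ys ->
  \sum_(y <- ys) (gap_mx ^+ m) x y ^+ 2 <= (gap_mx ^+ (m + m)) x x.
Proof.
move=> ys_uniq.
have -> : gap_mx ^+ (m + m) = gap_mx ^+ m *m (gap_mx ^+ m)^T by rewrite gap_pow_sym exprD.
rewrite -sum_sqr_row.
rewrite big_uniq //= [leRHS](bigID (mem ys)) /= lerDl sumr_ge0 // => i _.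
exact: sqr_ge0.
Qed.

(** Since A^2 = C - W, the squared norm of row x of W^m A is C times a diagonal
    entry of W^(2m) minus the same entry of W^(2m+1). *)
Lemma gap_pow_kernel m x y :
  ((gap_mx ^+ m *m A) x y) ^+ 2 <=
  C%:R * (gap_mx ^+ (m + m)) x x - (gap_mx ^+ (m + m).+1) x x.
Proof.
apply: le_trans (sqr_entry_le _ _ _) _; rewrite trmx_mul A_sym gap_pow_sym.
rewrite mulmxA -(mulmxA _ A A).
have -> : A *m A = C%:R%:M - gap_mx by rewrite /gap_mx opprB addrCA subrr addr0.
rewrite mulmxBr mulmxBl mul_mx_scalar -scalemxAl.
have -> : gap_mx ^+ m *m gap_mx = gap_mx ^+ m.+1 by rewrite exprSr.
have WW i j : gap_mx ^+ i *m gap_mx ^+ j = gap_mx ^+ (i + j) by rewrite exprD.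
by rewrite !WW addSn !mxE.
Qed.

Lemma Ac_herm : Ac \is hermsymmx.
Proof.
apply: realsym_hermsym; last by apply/mxOverP => i j; rewrite mxE realz.
by apply/is_hermitianmxP; rewrite expr0 scale1r map_mx_id // /Ac map_trmx A_sym.
Qed.

Lemma Ac_spectral : Ac = invmx U *m diag_mx (spectral_diag Ac) *m U.
Proof. exact/orthomx_spectralP/hermitian_normalmx/Ac_herm. Qed.

Lemma d_real i : d i \is Num.real.
Proof. exact: (mxOverP (hermitian_spectral_diag_real Ac_herm)). Qed.

Lemma z_ge0 i : 0 <= z i.
Proof. by rewrite /z real_exprn_even_ge0 ?d_real. Qed.

(** An eigenvalue is bounded by the largest column sum: compare the two sides of
    the eigenvector equation at a coordinate of maximal modulus. *)
Lemma z_leC i : z i <= C%:R.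
Proof.
pose u := row i U.
have uA : u *m Ac = d i *: u.
  rewrite /u Ac_spectral rowE -!mulmxA (mulmxA U) mulmxV ?spectral_unit // mul1mx.
  by rewrite mulmxA -rowE row_diag_mx -scalemxAl -rowE.
have u0 : u != 0.
  apply/eqP => u0; have := spectral_unit Ac; rewrite -row_free_unit => /row_freeP[V].
  move/(congr1 (row i)); rewrite row_mul -/U -/u u0 mul0mx => /rowP/(_ i)/eqP.
  by rewrite !mxE eqxx eq_sym oner_eq0.
have [j0 hj0] : exists j, u 0 j != 0.
  apply/existsP; apply: contraNT u0 => /existsPn h.
  by apply/eqP/rowP => j; rewrite [RHS]mxE; apply/eqP; have := h j; rewrite negbK.
have [j jmax] : exists j, forall k, `|u 0 k| <= `|u 0 j|.
  pose f k := `|u 0 k|.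
  have fr k : f k \is Num.real by exact: normr_real.
  have [j _ hj] := @real_arg_maxP _ _ j0 xpredT f isT (fun k _ => fr k).
  by exists j => k; apply: hj.
have uj0 : 0 < `|u 0 j| by apply: lt_le_trans (jmax j0); rewrite normr_gt0.
have dL : `|d i| <= L%:R.
  rewrite -(ler_pM2r uj0) -normrM.
  have -> : d i * u 0 j = (u *m Ac) 0 j by rewrite uA !mxE.
  rewrite mxE; apply: le_trans (ler_norm_sum _ _ _) _.
  apply: (@le_trans _ _ (\sum_k `|u 0 j| * `|Ac k j|)).
    by apply: ler_sum => k _; rewrite normrM ler_wpM2r.
  rewrite -mulr_sumr mulrC ler_wpM2r //.
  have := A_bound j; rewrite -(ler_int algC) rmorph_sum /=.
  by under eq_bigr do rewrite intr_norm; under [in X in _ -> X]eq_bigr do rewrite mxE.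
rewrite /z -real_normK ?d_real //.
apply: (@le_trans _ _ (L%:R ^+ 2)); first by rewrite lerXn2r ?nnegrE ?ler0n.
by rewrite -natrX ler_nat.
Qed.

Lemma gap_pow_spectral m x y : ((gap_mx ^+ m) x y)%:~R =
  \sum_k invmx U x k * (C%:R - z k) ^+ m * U k y.
Proof.
have -> : ((gap_mx ^+ m) x y)%:~R = (map_mx intr (gap_mx ^+ m) : 'M[algC]_N) x y by rewrite mxE.
pose e := \row_k (C%:R - z k).
have hG : map_mx intr gap_mx = invmx U *m diag_mx e *m U.
  have -> : diag_mx e = C%:R%:M - diag_mx (spectral_diag Ac) *m diag_mx (spectral_diag Ac).
    apply/matrixP => i j; rewrite mul_diag_mx !mxE /z /d.
    by case: eqVneq => [->|_]; rewrite ?mulr1n ?mulr0n ?mulr0 ?subr0 // expr2.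
  rewrite mulmxBr mulmxBl mul_mx_scalar -scalemxAl mulVmx ?spectral_unit //.
  rewrite /gap_mx map_mxB map_scalar_mx map_mxM -/Ac rmorph_nat scalemx1 {1 2}Ac_spectral.
  by rewrite !mulmxA mulmxK ?spectral_unit.
have -> : map_mx intr (gap_mx ^+ m) = invmx U *m diag_mx (\row_k e 0 k ^+ m) *m U.
  elim: m => [|m IH].
    rewrite expr0 map_mx1 (_ : diag_mx _ = 1%:M) ?mulmx1 ?mulVmx ?spectral_unit //.
    by apply/matrixP => i j; rewrite !mxE expr0.
  rewrite exprS map_mxM IH hG !mulmxA mulmxK ?spectral_unit // -(mulmxA (invmx U) (diag_mx e)).
  congr (_ *m _ *m _); apply/matrixP => i j; rewrite mul_diag_mx !mxE exprS.
  by case: eqP => _; rewrite ?mulr1n ?mulr0n ?mulr0.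
rewrite mxE; apply: eq_bigr => k _; rewrite mul_mx_diag !mxE //.
Qed.

Lemma Czk_ge0 k : 0 <= C%:R - z k.
Proof. by rewrite subr_ge0 z_leC. Qed.

Lemma gap_pow_diag m x : ((gap_mx ^+ m) x x)%:~R =
  \sum_k `|U k x| ^+ 2 * (C%:R - z k) ^+ m.
Proof.
rewrite gap_pow_spectral; apply: eq_bigr => k _.
rewrite invmx_unitary ?spectral_unitarymx // !mxE normCK.
by rewrite mulrAC [_ * U k x]mulrC.
Qed.

Lemma gap_pow_diag_ge0 m x : 0 <= (gap_mx ^+ m) x x.
Proof.
rewrite -(ler_int algC) gap_pow_diag sumr_ge0 // => k _.
by rewrite mulr_ge0 ?exprn_ge0 ?Czk_ge0.
Qed.

Lemma gap_pow_diag_decr m x : (gap_mx ^+ m.+1) x x <= C%:R * (gap_mx ^+ m) x x.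
Proof.
rewrite -(ler_int algC) intrM !gap_pow_diag mulr_sumr ler_sum // => k _.
rewrite [(_ - _) ^+ m.+1]exprS !(mulrCA (`|_| ^+ 2)) ler_wpM2r ?mulr_ge0 ?exprn_ge0 ?Czk_ge0 //.
by rewrite rmorph_nat gerBl z_ge0.
Qed.

Lemma gap_pow_trace m : (\tr (gap_mx ^+ m))%:~R = \sum_k (C%:R - z k) ^+ m.
Proof.
rewrite /mxtrace rmorph_sum /=; under eq_bigr do rewrite gap_pow_spectral.
rewrite exchange_big /=; apply: eq_bigr => k _.
have : (U *m invmx U) k k = 1 by rewrite mulmxV ?spectral_unit // mxE eqxx.
rewrite mxE => h; rewrite -[RHS]mul1r -h mulr_suml; apply: eq_bigr => x _.
by rewrite mulrAC [invmx U x k * _]mulrC.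
Qed.

(** The characteristic polynomial is X^r times the product q of the factors with
    nonzero eigenvalue, so q(0) is one of its coefficients, an integer, and it is
    nonzero. *)
Lemma prod_z_ge1 : 1 <= \prod_(k | d k != 0) z k.
Proof.
suff h : 1 <= `|\prod_(k | d k != 0) d k|.
  rewrite /z prodrXl -real_normK ?realX ?rpred_prod //; last by move=> *; apply: d_real.
  by rewrite exprn_ege1.
(* q(0) is, up to sign, the product of the nonzero eigenvalues. *)
pose q : {poly algC} := \prod_(k | d k != 0) ('X - (d k)%:P).
pose r := #|[pred k | d k == 0]|.
have hq : char_poly Ac = 'X^r * q.
  rewrite Ac_spectral char_poly_conj ?spectral_unit // char_poly_trig ?diag_mx_is_trig //.
  rewrite (bigID (fun k => d k == 0)) /=; congr (_ * _); last first.
    by apply: eq_bigr => k _; rewrite mxE eqxx mulr1n.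
  rewrite (eq_bigr (fun=> 'X)); last first.
    by move=> k /eqP hk; rewrite mxE eqxx mulr1n -/(d k) hk subr0.
  by rewrite prodr_const.
have q0 : q`_0 = \prod_(k | d k != 0) (- d k).
  rewrite -horner_coef0 /q horner_prod; apply: eq_bigr => k _.
  by rewrite hornerXsubC sub0r.
have qr : (char_poly Ac)`_r = q`_0 by rewrite hq coefXnM ltnn subnn.
have nz : q`_0 != 0 by rewrite q0; apply/prodf_neq0 => k hk; rewrite oppr_eq0.
have -> : `|\prod_(k | d k != 0) d k| = `|q`_0|.
  by rewrite q0 !normr_prod; apply: eq_bigr => k _; rewrite normrN.
move: nz; rewrite -qr /Ac -map_char_poly coef_map /=.
by rewrite intr_eq0 -intr_norm ler1z; lia.
Qed.

Variables (c s : nat).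
Hypothesis C_pow : C = (2 ^ c)%N.

Let small k := (d k != 0) && (z k * 2%:R ^+ s < 1).

(** Small nonzero eigenvalues must be compensated in the product by large ones,
    which are at most C = 2^c: 1 <= 2^(-s K) C^N, where K counts the small ones. *)
Lemma card_small_eigenvalues : (s * #|small| <= c * N)%N.
Proof.
have p2 : 0 <= 2%:R ^+ s :> algC by rewrite exprn_ge0 ?ler0n.
have C1 : (1 : algC) <= C%:R by rewrite C_pow ler1n expn_gt0.
suff : (2 ^ (s * #|small|) <= 2 ^ (c * N))%N by rewrite leq_exp2l.
rewrite -(ler_nat algC) natrX expnM -C_pow natrX exprM.
have -> : (2%:R ^+ s) ^+ #|small| = \prod_(k | small k) (2%:R ^+ s : algC).
  by rewrite prodr_const.
apply: (@le_trans _ _ (\prod_(k | small k) 2%:R ^+ s * \prod_(k | d k != 0) z k)).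
  rewrite ler_peMr ?prod_z_ge1 // prodr_ge0 // => k _; by rewrite exprn_ge0 ?ler0n.
rewrite [X in _ * X](bigID (fun k => z k * 2%:R ^+ s < 1)) /= mulrA -big_split /=.
rewrite -[leRHS]mul1r ler_pM ?mulr_ge0 ?prodr_ge0 //.
- by move=> k _; rewrite mulr_ge0 ?z_ge0 ?p2.
- by move=> k _; rewrite z_ge0.
- apply: prodr_ile1 => k /andP[_ hk]; rewrite mulr_ge0 ?z_ge0 ?p2 //=.
  by rewrite mulrC ltW.
- apply: (@le_trans _ _ (\prod_(k < N) C%:R)); last by rewrite prodr_const card_ord.
  rewrite [leRHS](bigID (fun k => (d k != 0) && ~~ (z k * 2%:R ^+ s < 1))) /=.
  rewrite -[leLHS]mulr1 ler_pM ?prodr_ge0 ?ler01 //.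
  + by move=> k _; apply: z_ge0.
  + by apply: ler_prod => k _; rewrite z_ge0 z_leC.
  + by elim/big_ind: _ => // x y hx hy; rewrite -[1]mulr1 ler_pM.
Qed.

Lemma bernoulli_inv (x : algC) (m : nat) : 0 <= x <= 1 -> (1 - x) ^+ m * (1 + m%:R * x) <= 1.
Proof.
move=> /andP[x0 x1]; elim: m => [|m IH]; first by rewrite expr0 mul0r addr0 mul1r.
apply: le_trans IH; rewrite exprS [_ * _ ^+ m]mulrC -mulrA ler_wpM2l ?exprn_ge0 ?subr_ge0 //.
rewrite -natr1 -subr_ge0.
have -> : 1 + m%:R * x - (1 - x) * (1 + (m%:R + 1) * x) = (m%:R + 1) * x ^+ 2 by ring.
by rewrite mulr_ge0 ?exprn_ge0 ?addr_ge0 ?ler0n ?ler01.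
Qed.

(** Eigenvalue 0 contributes nothing to the difference, a small eigenvalue at most
    1, and any other at most 1/(1 + s) by Bernoulli's inequality. *)
Lemma gap_pow_trace_rate (m m' : nat) : m = (s * 2 ^ (s + c))%N -> (m <= m')%N ->
  s%:R * (C%:R ^+ (m' - m) * \tr (gap_mx ^+ m) - \tr (gap_mx ^+ m')) <=
    (N * c.+1)%:R * C%:R ^+ m'.
Proof.
move=> hm mm'; rewrite -(ler_int algC) !rmorphM /= rmorphB rmorphM /= !rmorphXn /=.
rewrite !rmorph_nat !gap_pow_trace.
have p2 : 0 <= 2%:R ^+ s :> algC by rewrite exprn_ge0 ?ler0n.
have C0 : (0 : algC) < C%:R by rewrite ltr0n.
have C0' : (C%:R : algC) != 0 by rewrite gt_eqF.
pose b k := 1 - z k / C%:R.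
have zb01 k : 0 <= z k / C%:R <= 1.
  apply/andP; split; first by rewrite divr_ge0 ?z_ge0 // ltW.
  by rewrite ler_pdivrMr // mul1r z_leC.
have b01 k : 0 <= b k <= 1.
  by have /andP[h1 h2] := zb01 k; rewrite subr_ge0 h2 gerBl h1.
have bE k j : (C%:R - z k) ^+ j = C%:R ^+ j * b k ^+ j.
  by rewrite -exprMn mulrBr mulr1 mulrCA divff // mulr1.
rewrite mulr_sumr -sumrB [leRHS]mulrC.
have -> : \sum_k (C%:R ^+ (m' - m) * (C%:R - z k) ^+ m - (C%:R - z k) ^+ m') =
   C%:R ^+ m' * \sum_k (b k ^+ m - b k ^+ m').
  rewrite mulr_sumr; apply: eq_bigr => k _; rewrite !bE mulrA -exprD subnK //.
  by rewrite mulrBr.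
have Cm0 : 0 <= (C%:R : algC) ^+ m' by rewrite exprn_ge0 // ltW.
rewrite mulrCA ler_wpM2l // mulr_sumr -natrM.
apply: (@le_trans _ _ (\sum_k ((if small k then s%:R else 0) + 1))); last first.
  rewrite big_split /= -big_mkcond /= sumr_const sumr_const card_ord -mulrnA.
  rewrite -natrD ler_nat; apply: leq_trans (leq_add card_small_eigenvalues (leqnn N)) _.
  by rewrite mulnS mulnC addnC.
apply: ler_sum => k _.
have /andP[b0 b1] := b01 k.
have bm : b k ^+ m - b k ^+ m' <= b k ^+ m by rewrite gerBl exprn_ge0.
have bm1 : b k ^+ m <= 1 by rewrite exprn_ile1.
case: ifP => [_|].
  apply: (@le_trans _ _ (s%:R * 1)); last by rewrite mulr1 lerDl.
  by rewrite ler_wpM2l // (le_trans bm).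
rewrite add0r /small; have [dk0 _|dk0 /= /negbT] := eqVneq (d k) 0.
  by rewrite /b /z dk0 expr0n /= mul0r subr0 !expr1n subrr mulr0.
have zr : z k * 2%:R ^+ s \is Num.real by rewrite realM ?ger0_real ?z_ge0 ?p2.
rewrite -real_leNgt ?real1 // => hz.
apply: le_trans (ler_wpM2l _ bm) _ => //.
apply: le_trans (bernoulli_inv m (zb01 k)); rewrite mulrC ler_wpM2l ?exprn_ge0 //.
rewrite (@le_trans _ _ (m%:R * (z k / C%:R))) ?lerDr ?ler01 //.
have -> : m%:R * (z k / C%:R) = s%:R * (z k * 2%:R ^+ s).
  by rewrite hm expnD !natrM -C_pow natrX; field.
by rewrite ler_peMr.
Qed.

End SymmetricIntegerMatrix.

Local Close Scope sesquilinear_scope.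
(** * Matrices over the group ring and over finite quotients *)
Definition raw_int (z : int) : nat * nat :=
  match z with Posz k => (0%N, k) | Negz k => (1%N, k) end.
Definition zval (x : zdiff) : int := x.1%:Z - x.2%:Z.

Lemma zvalM x y : zval (zmul x y) = zval x * zval y.
Proof. rewrite /zval /zmul /=; lia. Qed.

Lemma zvalN x : zval (zopp x) = - zval x.
Proof. rewrite /zval /zopp /=; lia. Qed.

Lemma zval_raw z : zval (zdiff_of_sign (raw_int z)) = z.
Proof. by case: z => k; rewrite /zval /zdiff_of_sign /=; lia. Qed.

Definition raw_rows (m n : nat) (B : 'M[formal_sum m]_n) : rows :=
  [seq [seq [seq (raw_int t.1, raw_word t.2) | t <- B i j] | j <- enum 'I_n] | i <- enum 'I_n].

Lemma nth_raw_rows (m n : nat) (B : 'M[formal_sum m]_n) (i j : 'I_n) :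
  nth [::] (nth [::] (raw_rows B) i) j = [seq (raw_int t.1, raw_word t.2) | t <- B i j].
Proof.
rewrite /raw_rows (nth_map i) ?size_enum_ord // (nth_map j) ?size_enum_ord //.
by rewrite !nth_ord_enum.
Qed.

Lemma big_entries (V : nmodType) (m n : nat) (B : 'M[formal_sum m]_n)
    (F : zdiff * (nat * (nat * rword)) -> V) :
  \sum_(e <- entries n (raw_rows B)) F e =
  \sum_i \sum_j \sum_(t <- B i j)
    F (zdiff_of_sign (raw_int t.1), (nat_of_ord i, (nat_of_ord j, raw_word t.2))).
Proof.
rewrite /entries big_flatten big_map -[n in iota 0 n]subn0 -/(index_iota 0 n) big_mkord.
apply: eq_bigr => i _; rewrite big_flatten big_map -/(index_iota 0 n) big_mkord.
by apply: eq_bigr => j _; rewrite nth_raw_rows !big_map.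
Qed.

Lemma eq_mulgr (K : groupType) (x y g : K) : (x * y == g)%g = (x == g * y^-1)%g.
Proof. by apply/eqP/eqP => [<-|->]; rewrite ?mulgK ?mulgKV. Qed.

Section Coefficients.
Variables (m n : nat) (B : 'M[formal_sum m]_n) (K : groupType) (s : 'I_m -> K).
Local Notation es := (entries n (raw_rows B)).
Local Notation rv := (rval (gen_val s)).

Definition coef (v : fvec) (j : nat) (g : K) : int :=
  \sum_(t <- v | (t.2.1 == j) && (rv t.2.2 == g)) zval t.1.

Definition in_range (v : fvec) := all (fun t => t.2.1 < n)%N v.

(** Right multiplication by the matrix represented by B, on functions of integers
    over any group in which its words have values. The same formula serves for G,
    its finite quotients and, with complex values, for [right_mul]. *)
Definition apply_mx (x : 'I_n -> K -> int) (j : 'I_n) (g : K) : int :=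
  \sum_i \sum_(t <- B i j) t.1 * x i (g * (word_val s t.2)^-1)%g.

Lemma coef_fmul v (j : 'I_n) g : in_range v ->
  coef (fmul v es) j g = apply_mx (coef v) j g.
Proof.
move=> vr; rewrite /coef /apply_mx /fmul big_flatten big_map big_seq.
transitivity (\sum_(t <- v) \sum_i \sum_(e <- B i j)
   if (t.2.1 == i :> nat) && (rv t.2.2 == g * (word_val s e.2)^-1)%g then zval t.1 * e.1 else 0).
  rewrite big_seq; apply: eq_bigr => t tv; rewrite big_flatten big_map big_entries.
  apply: eq_bigr => i _; rewrite (bigD1 j) //= [X in _ + X]big1 ?addr0; last first.
    move=> j' jj'; rewrite big1 // => e _; case: ifP => _; rewrite ?big_nil // big_cons big_nil /=.
    by rewrite (negbTE jj' : (j' == j :> nat) = false).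
  apply: eq_bigr => e _; rewrite eq_sym; case: ifP => _ /=; rewrite ?big_nil // big_cons big_nil /=.
  rewrite eqxx /= rval_cat rval_raw addr0 zvalM zval_raw.
  by rewrite eq_mulgr.
rewrite exchange_big /=; apply: eq_bigr => i _.
rewrite exchange_big /=; apply: eq_bigr => e _.
rewrite mulr_sumr [RHS]big_mkcond /=; apply: eq_bigr => t _.
by rewrite [_ * e.1]mulrC.
Qed.

Lemma in_range_fmul v : in_range (fmul v es).
Proof.
apply/allP => x /flattenP[l /mapP[t _ ->]] /flattenP[l' /mapP[e he ->]].
case: ifP => // _; rewrite inE => /eqP-> /=.
move: he => /flattenP[l1 /mapP[i _ ->]] /flattenP[l2 /mapP[j hj ->]] /mapP[t' _ ->] /=.
by rewrite mem_iota in hj.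
Qed.

Lemma in_range_fstep C v : in_range v -> in_range (fstep C es v).
Proof.
move=> hv; rewrite /in_range /fstep all_cat !all_map; apply/andP; split; first exact: hv.
exact: in_range_fmul.
Qed.

Lemma in_range_fpow C k (i : 'I_n) : in_range (fpow C es k i).
Proof. by elim: k => [|k IH]; [rewrite /in_range /= ltn_ord | apply: in_range_fstep]. Qed.

Lemma coef_fstep C v (j : 'I_n) g : in_range v ->
  coef (fstep C es v) j g = C%:R * coef v j g - apply_mx (apply_mx (coef v)) j g.
Proof.
move=> hv; rewrite /coef /fstep big_cat !big_map /=; congr (_ + _).
  by rewrite mulr_sumr; apply: eq_bigr => t _; rewrite zvalM /zval /=; lia.
transitivity (- coef (fmul (fmul v es) es) j g).
  by rewrite /coef -sumrN; apply: eq_bigr => t _; rewrite zvalN.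
rewrite coef_fmul ?in_range_fmul //; congr (- _); apply: eq_bigr => i _.
by apply: eq_bigr => t _; rewrite coef_fmul.
Qed.

Lemma coef_fpow0 C i j g : coef (fpow C es 0 i) j g = ((i == j) && (1%g == g))%:R.
Proof. by rewrite /coef /= big_mkcond big_seq1 /= rval_nil; case: (_ && _). Qed.

End Coefficients.

Definition l1_norm (m n : nat) (B : 'M[formal_sum m]_n) : nat :=
  \sum_i \sum_j \sum_(t <- B i j) `|t.1|%N.

(** Self-adjointness tested against functions: this form survives the passage to
    a quotient, where words with different values may be identified. *)
Definition adjoint_symmetric (m n : nat) (B : 'M[formal_sum m]_n) (K : groupType) (s : 'I_m -> K) :=
  forall i j (phi : K -> int),
  \sum_(t <- B i j) t.1 * phi (word_val s t.2) =
  \sum_(t <- B j i) t.1 * phi (word_val s t.2)^-1%g.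

Section FiniteQuotient.
Variables (m n : nat) (B : 'M[formal_sum m]_n) (H : finGroupType) (s : 'I_m -> H).
Hypothesis B_sym : adjoint_symmetric B s.
Local Notation es := (entries n (raw_rows B)).
Local Notation T := ('I_n * H)%type.
Local Notation N := #|{: T}|.
Local Notation ev := (@enum_val T xpredT).

(** The matrix of right multiplication on the n|H| basis vectors (i, h). *)
Definition quo_mx : 'M[int]_N := \matrix_(a, b)
  \sum_(t <- B (ev a).1 (ev b).1 | ((ev a).2 * word_val s t.2 == (ev b).2)%g) t.1.

Definition rowv (x : 'I_n -> H -> int) : 'rV[int]_N := \row_b x (ev b).1 (ev b).2.

Lemma sum_ev (V : nmodType) (F : T -> V) : \sum_(a : 'I_N) F (ev a) = \sum_i \sum_h F (i, h).
Proof.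
rewrite pair_bigA /= [RHS](reindex _ (onW_bij _ (enum_val_bij _))) /=.
by apply: eq_bigr => a _; rewrite -surjective_pairing.
Qed.

Lemma rowv_mul x : rowv x *m quo_mx = rowv (apply_mx B s x).
Proof.
apply/rowP => b; rewrite !mxE.
under eq_bigr => a _ do rewrite !mxE.
rewrite (sum_ev (fun p => x p.1 p.2 *
  \sum_(t <- B p.1 (ev b).1 | (p.2 * word_val s t.2 == (ev b).2)%g) t.1)) /apply_mx.
apply: eq_bigr => i _ /=; under eq_bigr do rewrite mulr_sumr big_mkcond /=.
rewrite exchange_big /=; apply: eq_bigr => t _.
rewrite (bigD1 ((ev b).2 * (word_val s t.2)^-1)%g) //= mulgKV eqxx big1 ?addr0; first by rewrite mulrC.
by move=> h hne; rewrite eq_mulgr (negbTE hne).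
Qed.

Lemma quo_mx_sym : quo_mx^T = quo_mx.
Proof.
apply/matrixP => a b; rewrite !mxE big_mkcond [RHS]big_mkcond /=.
have ifE (c : bool) (x : int) : (if c then x else 0) = x * c%:R by case: c; rewrite ?mulr1 ?mulr0.
under eq_bigr do rewrite ifE; under [RHS]eq_bigr do rewrite ifE eq_mulgr eq_sym.
rewrite (B_sym (ev b).1 (ev a).1 (fun h => (((ev b).2 * h)%g == (ev a).2)%:R)).
by apply: eq_bigr => t _; rewrite eq_sym.
Qed.

(** For fixed i and fixed word, right translation hits a given h' from exactly one
    h, so each coefficient is counted at most once in a column. *)
Lemma quo_mx_bound b : \sum_a `|quo_mx a b| <= (l1_norm B)%:Z.
Proof.
under eq_bigr do rewrite mxE.
rewrite (sum_ev (fun p => `|\sum_(t <- B p.1 (ev b).1 | (p.2 * word_val s t.2 == (ev b).2)%g) t.1|)) /=.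
have -> : (l1_norm B)%:Z = \sum_i \sum_j \sum_(t <- B i j) `|t.1|.
  rewrite /l1_norm -natz natr_sum; apply: eq_bigr => i _; rewrite natr_sum.
  by apply: eq_bigr => j _; rewrite natr_sum; apply: eq_bigr => t _; rewrite natz abszE.
apply: ler_sum => i _; rewrite (bigD1 (ev b).1) //= -[leLHS]addr0 lerD ?sumr_ge0 //; last first.
  by move=> j _; rewrite sumr_ge0.
apply: (@le_trans _ _ (\sum_h \sum_(t <- B i (ev b).1 | (h * word_val s t.2 == (ev b).2)%g) `|t.1|)).
  by apply: ler_sum => h _; apply: ler_norm_sum.
under [leLHS]eq_bigr => h _ do rewrite big_mkcond /=.
rewrite exchange_big /= ler_sum // => t _.
rewrite (bigD1 ((ev b).2 * (word_val s t.2)^-1)%g) //= mulgKV eqxx big1 ?addr0 //.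
by move=> h hne; rewrite eq_mulgr (negbTE hne).
Qed.

Definition shift (h0 : H) (x : 'I_n -> H -> int) j h := x j (h0^-1 * h)%g.

Lemma apply_mx_shift h0 x : apply_mx B s (shift h0 x) = shift h0 (apply_mx B s x).
Proof.
apply/funext => j; apply/funext => h; rewrite /apply_mx /shift.
by apply: eq_bigr => i _; apply: eq_bigr => t _; rewrite mulgA.
Qed.

(** The formal iteration started at e_i computes the rows with index (i, 1); the
    other rows are left translates of these. *)
Lemma row_gap_pow C k a : row a (gap_mx quo_mx C ^+ k) =
  rowv (shift (ev a).2 (coef s (fpow C es k (ev a).1))).
Proof.
elim: k => [|k IH].
  apply/rowP => b; rewrite expr0 !mxE /shift coef_fpow0.
  rewrite -(inj_eq enum_val_inj) [ev a]surjective_pairing [ev b]surjective_pairing xpair_eqE /=.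
  congr ((_ && _)%:R); apply/eqP/eqP => [->|h]; first by rewrite mulVg.
  by rewrite -[RHS](mulKVg (ev a).2) -h mulg1.
rewrite exprSr row_mul IH /gap_mx mulmxBr mul_mx_scalar mulmxA !rowv_mul.
rewrite !apply_mx_shift; apply/rowP => b.
by rewrite !mxE /shift coef_fstep ?in_range_fpow.
Qed.

Lemma gap_pow_coef C k a b : (gap_mx quo_mx C ^+ k) a b =
  coef s (fpow C es k (ev a).1) (ev b).1 ((ev a).2^-1 * (ev b).2)%g.
Proof. by have /rowP/(_ b) := row_gap_pow C k a; rewrite !mxE. Qed.

Lemma gap_pow_mul_coef C k a b : (gap_mx quo_mx C ^+ k *m quo_mx) a b =
  coef s (fmul (fpow C es k (ev a).1) es) (ev b).1 ((ev a).2^-1 * (ev b).2)%g.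
Proof.
have -> : (gap_mx quo_mx C ^+ k *m quo_mx) a b = (row a (gap_mx quo_mx C ^+ k) *m quo_mx) 0 b.
  by rewrite -row_mul [RHS]mxE.
by rewrite row_gap_pow rowv_mul mxE apply_mx_shift coef_fmul ?in_range_fpow.
Qed.

Lemma gap_pow_trace_coef C k : \tr (gap_mx quo_mx C ^+ k) =
  #|H|%:R * \sum_(i < n) coef s (fpow C es k i) i 1%g.
Proof.
rewrite /mxtrace; under eq_bigr do rewrite gap_pow_coef mulVg.
rewrite (sum_ev (fun p => coef s (fpow C es k p.1) p.1 1%g)) /= mulr_sumr.
by apply: eq_bigr => i _; rewrite sumr_const mulr_natl.
Qed.

End FiniteQuotient.

(** * Transfer of inequalities from finite quotients *)
Lemma residually_finite_injects (G : groupType) (gs : seq G) :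
  residually_finite G ->
  exists (H : finGroupType) (f : G -> H),
    {morph f : x y / (x * y)%g} /\ {in gs &, injective f}.
Proof.
move=> rf.
have [|H [f [fM hf]]] := @residually_finite_separates G
    [seq z <- [seq (x * y^-1)%g | x <- gs, y <- gs] | z != 1%g] rf.
  by move=> g; rewrite mem_filter => /andP[].
exists H, f; split=> // x y hx hy fxy; apply/eqP; apply: contraT => xy.
have /hf/eqP : (x * y^-1)%g \in [seq z <- [seq (x * y^-1)%g | x <- gs, y <- gs] | z != 1%g].
  by rewrite mem_filter eq_mulgr invgK mul1g xy (allpairs_f (fun x y => x * y^-1)%g).
by rewrite fM morphVg // fxy mulgV.
Qed.

Section Transfer.
Variables (m n : nat) (B : 'M[formal_sum m]_n) (G : groupType) (s : 'I_m -> G).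
Hypothesis G_rf : residually_finite G.
Hypothesis B_sym : adjoint_symmetric B s.
Variable C : nat.
Hypothesis B_C : (l1_norm B ^ 2 <= C)%N.
Hypothesis C_gt0 : (0 < C)%N.
Local Notation es := (entries n (raw_rows B)).

Definition vals (v : fvec) : seq G := [seq rval (gen_val s) t.2.2 | t <- v].

(** The coefficient at (j, g) of e_i (C - A^2)^k. *)
Definition gap_coef k (i j : 'I_n) g : int := coef s (fpow C es k i) j g.
Definition gap_moment k (i : 'I_n) : int := gap_coef k i i 1%g.

Section Quotient.
Variables (H : finGroupType) (f : G -> H).
Hypothesis fM : {morph f : x y / (x * y)%g}.

Lemma word_val_morph w : word_val (f \o s) w = f (word_val s w).
Proof.
rewrite -!rval_raw morph_rval //; congr (rval _ _); apply/funext => i /=.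
by rewrite /gen_val; case: insub => //=; rewrite morph1g.
Qed.

Lemma quo_sym : adjoint_symmetric B (f \o s).
Proof.
move=> i j phi; have := B_sym i j (phi \o f); rewrite /=.
under eq_bigr do rewrite -word_val_morph.
by move=> ->; apply: eq_bigr => t _; rewrite word_val_morph morphVg.
Qed.

(** Coefficients do not change in a quotient in which no two of the elements at
    hand become equal. *)
Lemma coef_quo v j g : {in g :: vals v &, injective f} ->
  coef (f \o s) v j (f g) = coef s v j g.
Proof.
move=> finj; rewrite /coef big_mkcond [RHS]big_mkcond big_seq [RHS]big_seq; apply: eq_bigr => t tv.
have -> : gen_val (f \o s) = f \o gen_val s.
  by apply/funext => i; rewrite /gen_val /=; case: insub => //=; rewrite morph1g.
rewrite -morph_rval // (inj_in_eq finj) ?inE ?eqxx //.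
by rewrite (map_f (fun t : zdiff * (nat * rword) => rval (gen_val s) t.2.2)) // orbT.
Qed.

Definition idx (i : 'I_n) (g : G) : 'I_#|{: 'I_n * H}| := enum_rank (i, f g).

Local Notation W := (gap_mx (quo_mx B (f \o s)) C).

Lemma gap_pow_gap_coef k (i j : 'I_n) g : {in g :: vals (fpow C es k i) &, injective f} ->
  (W ^+ k) (idx i 1%g) (idx j g) = gap_coef k i j g.
Proof.
by move=> finj; rewrite gap_pow_coef !enum_rankK /= morph1g // invg1 mul1g coef_quo.
Qed.

Lemma gap_pow_gap_moment k (i : 'I_n) : {in 1%g :: vals (fpow C es k i) &, injective f} ->
  (W ^+ k) (idx i 1%g) (idx i 1%g) = gap_moment k i.
Proof. exact: gap_pow_gap_coef. Qed.

End Quotient.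

(* Injectivity on a list passes to the lists it is made of. *)
Local Ltac sub_inj := apply: sub_in2 => ?; rewrite !(inE, mem_cat);
  repeat case/orP; move=> ->; rewrite ?orbT.

Lemma gap_moment_ge0 k (i : 'I_n) : 0 <= gap_moment k i.
Proof.
have [H [f [fM finj]]] := residually_finite_injects (1%g :: vals (fpow C es k i)) G_rf.
rewrite -(gap_pow_gap_moment fM finj); exact: (gap_pow_diag_ge0 (quo_mx_sym (quo_sym fM)) (quo_mx_bound _ _) B_C).
Qed.

Lemma gap_moment_decr k (i : 'I_n) : gap_moment k.+1 i <= C%:R * gap_moment k i.
Proof.
have [H [f [fM finj]]] := residually_finite_injects
  (1%g :: vals (fpow C es k i) ++ vals (fpow C es k.+1 i)) G_rf.
rewrite -!(gap_pow_gap_moment fM); [|by move: finj; sub_inj..].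
exact: (gap_pow_diag_decr (quo_mx_sym (quo_sym fM)) (quo_mx_bound _ _) B_C).
Qed.

Lemma gap_coef_cauchy l k (i j : 'I_n) g :
  (C%:R ^+ k * gap_coef l i j g - C%:R ^+ l * gap_coef k i j g) ^+ 2 <=
  C%:R ^+ (k + k) * gap_moment (l + l) i
  - 2%:R * C%:R ^+ (l + k) * gap_moment (l + k) i
  + C%:R ^+ (l + l) * gap_moment (k + k) i.
Proof.
have [H [f [fM finj]]] := residually_finite_injects
  (1%g :: g :: vals (fpow C es l i) ++ vals (fpow C es k i) ++ vals (fpow C es (l + l) i)
   ++ vals (fpow C es (l + k) i) ++ vals (fpow C es (k + k) i)) G_rf.
rewrite -!(gap_pow_gap_moment fM) -?(gap_pow_gap_coef fM); [|by move: finj; sub_inj..].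
exact/gap_pow_cauchy/quo_mx_sym/quo_sym.
Qed.

Lemma gap_coef_bessel l (i : 'I_n) (ys : seq ('I_n * G)) : uniq ys ->
  \sum_(y <- ys) gap_coef l i y.1 y.2 ^+ 2 <= gap_moment (l + l) i.
Proof.
move=> ys_uniq.
have [H [f [fM finj]]] := residually_finite_injects
  (1%g :: [seq y.2 | y <- ys] ++ vals (fpow C es l i) ++ vals (fpow C es (l + l) i)) G_rf.
have yE : {in ys, forall y, (gap_mx (quo_mx B (f \o s)) C ^+ l) (idx f i 1%g) (idx f y.1 y.2) = gap_coef l i y.1 y.2}.
  move=> y hy; apply: gap_pow_gap_coef => //; move: finj; apply: sub_in2 => x.
  rewrite !(inE, mem_cat) => /orP[/eqP->|->]; last by rewrite !orbT.
  by rewrite (map_f snd hy) orbT.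
rewrite -(gap_pow_gap_moment fM); last by move: finj; sub_inj.
rewrite big_seq; under eq_bigr => y hy do rewrite -yE //.
rewrite -big_seq -(big_map (fun y => idx f y.1 y.2) xpredT
  (fun b => (gap_mx (quo_mx B (f \o s)) C ^+ l) (idx f i 1%g) b ^+ 2)).
apply: gap_pow_bessel; first exact/quo_mx_sym/quo_sym.
rewrite map_inj_in_uniq // => -[j1 g1] [j2 g2] h1 h2 /enum_rank_inj [-> fg]; congr (_, _).
apply: finj => //; rewrite !(inE, mem_cat).
  by rewrite (map_f snd h1) orbT.
by rewrite (map_f snd h2) orbT.
Qed.

Lemma gap_coef_kernel l (i j : 'I_n) g :
  (apply_mx B s (gap_coef l i) j g) ^+ 2 <= C%:R * gap_moment (l + l) i - gap_moment (l + l).+1 i.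
Proof.
have [H [f [fM finj]]] := residually_finite_injects
  (1%g :: g :: vals (fmul (fpow C es l i) es) ++ vals (fpow C es (l + l) i)
   ++ vals (fpow C es (l + l).+1 i)) G_rf.
have := gap_pow_kernel C (quo_mx_sym (quo_sym fM)) l (idx f i 1%g) (idx f j g).
rewrite !(gap_pow_gap_moment fM); [|by move: finj; sub_inj..].
rewrite gap_pow_mul_coef !enum_rankK /= morph1g // invg1 mul1g coef_quo //.
  by rewrite coef_fmul ?in_range_fpow.
by move: finj; sub_inj.
Qed.

(** The trace in the quotient is |H| times the sum of the n moments, and the size
    of the matrix is n|H|; the factor |H| cancels. *)
Lemma gap_moment_rate (c e k k' : nat) : C = (2 ^ c)%N -> k = (e * 2 ^ (e + c))%N -> (k <= k')%N ->
  e%:R * (C%:R ^+ (k' - k) * \sum_i gap_moment k i - \sum_i gap_moment k' i) <= (n * c.+1)%:R * C%:R ^+ k'.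
Proof.
move=> hC hk kk'.
have [H [f [fM finj]]] := residually_finite_injects
  (1%g :: flatten [seq vals (fpow C es k i) ++ vals (fpow C es k' i) | i : 'I_n]) G_rf.
have dE l : l \in [:: k; k'] -> \sum_(i < n) coef (f \o s) (fpow C es l i) i 1%g = \sum_i gap_moment l i.
  move=> hl; apply: eq_bigr => i _; rewrite -{1}(morph1g fM) coef_quo //.
  move: finj; apply: sub_in2 => x; rewrite !inE => /orP[->//|hx]; apply/orP; right.
  apply/flattenP; exists (vals (fpow C es k i) ++ vals (fpow C es k' i)).
    by apply/mapP; exists i; rewrite ?mem_enum.
  by move: hl hx; rewrite !inE mem_cat => /orP[]/eqP-> ->; rewrite ?orbT.
have := gap_pow_trace_rate (quo_mx_sym (quo_sym fM)) (quo_mx_bound B (f \o s)) B_C C_gt0 hC hk kk'.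
rewrite !gap_pow_trace_coef !dE ?inE ?eqxx ?orbT // card_prod card_ord.
have H0 : (0 : int) < #|H|%:R by rewrite ltr0n; apply/card_gt0P; exists 1%g.
set S := \sum_i _; set S' := \sum_i _ => h; rewrite -(ler_pM2l H0).
have eq_le (x y : int) : x = y -> x <= y by move=> ->.
apply: le_trans (le_trans h _); apply: eq_le; first by ring.
by rewrite !natrM; ring.
Qed.

End Transfer.

(** * The group ring acting on functions *)
Section GroupRing.
Variables (m : nat) (G : groupType) (s : 'I_m -> G).

Lemma sum_finsupp (V : zmodType) (S : {fset G}) (F : G -> int) (phi : G -> V) :
  let a := [fsfun g in S => F g | 0] : group_ring G in
  \sum_(h <- finsupp a) phi h *~ a h = \sum_(h <- S) phi h *~ F h.
Proof.
move=> a; have aE h : a h = if h \in S then F h else 0 by rewrite fsfunE.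
rewrite (big_fset_incl _ (B := S)) /=.
- by apply: eq_big_seq => h hS; rewrite aE hS.
- by apply/fsubsetP => h; rewrite mem_finsupp aE; case: ifP => //; rewrite eqxx.
- by move=> h _; rewrite memNfinsupp => /eqP->; rewrite mulr0z.
Qed.

Lemma sum_gr_of_sum (V : zmodType) (a : formal_sum m) (phi : G -> V) :
  \sum_(h <- finsupp (gr_of_sum s a)) phi h *~ gr_of_sum s a h =
  \sum_(t <- a) phi (word_val s t.2) *~ t.1.
Proof.
rewrite sum_finsupp /=; under eq_bigr do rewrite mulrz_sumr big_mkcond /=.
rewrite exchange_big /= big_seq [RHS]big_seq; apply: eq_bigr => t ta.
have tS : word_val s t.2 \in [fset word_val s t.2 | t in a]%fset.
  by apply/imfsetP; exists t.
rewrite (big_fsetD1 _ tS) /= eqxx big_seq big1 ?addr0 // => h.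
by rewrite !inE eq_sym => /andP[/negbTE->].
Qed.

Variables (n : nat) (B : 'M[formal_sum m]_n).

Lemma right_mul_gr (R : realType) (x : tuple_fun R G n) j g :
  right_mul (gr_mx s B) x j g =
  \sum_i \sum_(t <- B i j) (t.1)%:~R * x i (g * (word_val s t.2)^-1)%g.
Proof.
apply: eq_bigr => i _; under eq_bigr do rewrite mulrzl.
rewrite mxE (sum_gr_of_sum _ (fun h => x i (g * h^-1)%g)).
by apply: eq_bigr => t _; rewrite mulrzl.
Qed.

Lemma self_adjoint_sum (V : zmodType) (phi : G -> V) i j :
  self_adjoint (gr_mx s B) ->
  \sum_(t <- B i j) phi (word_val s t.2) *~ t.1 =
  \sum_(t <- B j i) phi (word_val s t.2)^-1%g *~ t.1.
Proof.
move=> sa; rewrite -(sum_gr_of_sum _ (fun h => phi h^-1%g)) -sum_gr_of_sum.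
have -> : gr_of_sum s (B i j) = gr_star (gr_of_sum s (B j i)).
  by move/matrixP/(_ i j): sa; rewrite !mxE.
rewrite /gr_star sum_finsupp big_imfset /=; last by move=> x y _ _; apply: invg_inj.
by apply: eq_bigr => h _; rewrite invgK.
Qed.

Lemma self_adjoint_symmetric : self_adjoint (gr_mx s B) -> adjoint_symmetric B s.
Proof.
move=> sa i j phi.
under eq_bigr do rewrite mulrC -mulrzz; under [RHS]eq_bigr do rewrite mulrC -mulrzz.
exact: self_adjoint_sum.
Qed.

Section Pairing.
Variables (R : realType) (y : tuple_fun R G n).
Local Notation es := (entries n (raw_rows B)).
Hypothesis sa : self_adjoint (gr_mx s B).

(** The bilinear pairing of a finitely supported formal vector with an arbitrary
    function; no convergence is involved. *)
Definition pairing (z : tuple_fun R G n) (v : fvec) : R[i] :=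
  \sum_(j < n) \sum_(t <- v | t.2.1 == j) z j (rval (gen_val s) t.2.2) *~ zval t.1.

Lemma pairing_fmul z v : in_range n v ->
  pairing z (fmul v es) = pairing (right_mul (gr_mx s B) z) v.
Proof.
move=> vr; rewrite /pairing.
transitivity (\sum_(j < n) \sum_(t <- v) \sum_(i < n | t.2.1 == i)
  (\sum_(e <- B i j) z j (rval (gen_val s) t.2.2 * word_val s e.2)%g *~ e.1) *~ zval t.1).
  apply: eq_bigr => j _; rewrite /fmul big_flatten big_map; apply: eq_bigr => t _.
  rewrite big_flatten big_map big_entries [RHS]big_mkcond; apply: eq_bigr => i _.
  rewrite (bigD1 j) //= [X in _ + X]big1 ?addr0; last first.
    move=> j' jj'; rewrite big1 // => e _; case: ifP => _; rewrite ?big_nil // big_mkcond big_seq1 /=.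
    by rewrite (negbTE jj' : (j' == j :> nat) = false).
  rewrite [_ == (i : nat)]eq_sym; case: ifP => _; last by rewrite big1 // => e _; rewrite big_nil.
  rewrite mulrz_suml; apply: eq_bigr => e _; rewrite big_mkcond big_seq1 /= eqxx.
  by rewrite rval_cat rval_raw zvalM zval_raw mulrC mulrzA.
rewrite exchange_big /= [RHS](exchange_big_dep xpredT) //=.
apply: eq_bigr => t _.
rewrite exchange_big /=; apply: eq_bigr => i _.
rewrite right_mul_gr mulrz_suml; apply: eq_bigr => j _; congr (_ *~ _).
rewrite (self_adjoint_sum (fun h => z j (rval (gen_val s) t.2.2 * h)%g)) //.
by apply: eq_bigr => e _; rewrite mulrzl.
Qed.

(** On the kernel of A the operator C - A^2 is multiplication by C. *)
Lemma pairing_fpow C k (i : 'I_n) : right_mul (gr_mx s B) y = (fun _ _ => 0) ->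
  pairing y (fpow C es k i) = C%:R ^+ k * y i 1%g.
Proof.
move=> y0; elim: k => [|k IH].
  rewrite /pairing /= (bigD1 i) //= big_mkcond big_seq1 /= eqxx big1 ?addr0.
    by rewrite rval_nil mul1r.
  by move=> j ji; rewrite big_mkcond big_seq1 /= eq_sym (negbTE ji : (j == i :> nat) = false).
transitivity (C%:R * pairing y (fpow C es k i) - pairing y (fmul (fmul (fpow C es k i) es) es)).
  rewrite /pairing mulr_sumr -sumrB; apply: eq_bigr => j _ /=.
  rewrite /fstep big_cat !big_map /= mulr_sumr -sumrN; congr (_ + _); apply: eq_bigr => t _.
    by rewrite zvalM /zval /= subr0 mulrzA mulr_natl pmulrn mulrzAC.
  by rewrite zvalN mulrNz.
rewrite pairing_fmul ?in_range_fmul // y0 IH mulrA -exprS.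
by rewrite {1}/pairing big1 ?subr0 // => j _; rewrite big1 // => t _; rewrite mul0rz.
Qed.

Lemma pairing_coef z v (S : {fset G}) :
  {subset [seq rval (gen_val s) t.2.2 | t <- v] <= S} ->
  pairing z v = \sum_(j < n) \sum_(g <- S) z j g *~ coef s v j g.
Proof.
move=> vS; apply: eq_bigr => j _.
under [RHS]eq_bigr => g _ do rewrite /coef mulrz_sumr big_mkcond /=.
rewrite exchange_big /= [LHS]big_mkcond /= big_seq [RHS]big_seq; apply: eq_bigr => t tv.
have tS : rval (gen_val s) t.2.2 \in S by apply: vS; exact: (map_f (fun t => rval (gen_val s) t.2.2)).
rewrite (big_fsetD1 _ tS) /= eqxx andbT big_seq big1 ?addr0 // => g.
by rewrite !inE eq_sym => /andP[/negbTE->]; rewrite andbF.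
Qed.

End Pairing.
End GroupRing.

(** * Unordered sums *)
Import ComplexField.
Local Notation normc := Normc.normc.
Section UnorderedSums.
Variables (R : realType) (T : choiceType).
Implicit Types (a : T -> R) (h : T -> R[i]).

Definition bounded_sums a := exists M, forall F : {fset T}, \sum_(g <- F) a g <= M.

Definition rsum a (l : R) := forall e, 0 < e ->
  exists F0 : {fset T}, forall F : {fset T}, (F0 `<=` F)%fset -> `|l - \sum_(g <- F) a g| < e.

(** Convergence of the net of finite partial sums in terms of real tolerances;
    [csum_sum] relates it to the limit used to define [inner]. *)
Definition csum h (l : R[i]) := forall e, 0 < e ->
  exists F0 : {fset T}, forall F : {fset T}, (F0 `<=` F)%fset -> normc (l - \sum_(g <- F) h g) < e.

Lemma big_fset_le a (F F' : {fset T}) : (forall g, 0 <= a g) -> (F `<=` F')%fset ->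
  \sum_(g <- F) a g <= \sum_(g <- F') a g.
Proof.
move=> a0 FF'; rewrite [leRHS](big_fsetID _ (mem F)) /=.
have -> : [fset x in F' | x \in F]%fset = F.
  by apply/fsetP => x; rewrite !inE andb_idl // => /(fsubsetP FF').
by rewrite lerDl sumr_ge0.
Qed.

Lemma rsum_exists_ge0 a : (forall g, 0 <= a g) -> bounded_sums a -> exists l, rsum a l.
Proof.
move=> a0 [M hM]; pose E := [set x : R | exists F : {fset T}, x = \sum_(g <- F) a g]%classic.
have hE : has_sup E.
  split; first by exists 0, fset0; rewrite big_seq_fset0.
  by exists M => _ [F ->].
exists (sup E) => e e0; have [_ [F0 ->] hF0] := sup_adherent e0 hE.
exists F0 => F FF; rewrite ger0_norm ?subr_ge0; last first.
  by apply: ub_le_sup; [exact: hE.2 | exists F].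
by rewrite ltrBlDr -ltrBlDl; apply: lt_le_trans hF0 (big_fset_le a0 FF).
Qed.

Lemma rsumB a b l k : rsum a l -> rsum b k -> rsum (fun g => a g - b g) (l - k).
Proof.
move=> ha hb e e0; have e2 : 0 < e / 2 by rewrite divr_gt0.
have [F1 h1] := ha _ e2; have [F2 h2] := hb _ e2.
exists (F1 `|` F2)%fset => F; rewrite fsubUset => /andP[/h1 + /h2].
rewrite sumrB; set A := \sum_(_ <- _) _; set B := \sum_(_ <- _) _ => hA hB.
have -> : l - k - (A - B) = (l - A) - (k - B) by ring.
by rewrite [e]splitr (le_lt_trans (ler_normB _ _)) // ltrD.
Qed.

Lemma bounded_sums_le a b : (forall g, a g <= b g) -> bounded_sums b -> bounded_sums a.
Proof.
move=> ab [M hM]; exists M => F; apply: le_trans (hM F).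
by apply: ler_sum.
Qed.

Lemma bounded_sumsD a b : bounded_sums a -> bounded_sums b -> bounded_sums (fun g => a g + b g).
Proof. by move=> [M hM] [N hN]; exists (M + N) => F; rewrite big_split lerD. Qed.

(** The summand is the difference of |a| + a and |a|, both nonnegative. *)
Lemma rsum_exists a : bounded_sums (fun g => `|a g|) -> exists l, rsum a l.
Proof.
move=> ha; have [l1 h1] := rsum_exists_ge0 (fun g => normr_ge0 (a g)) ha.
have [] := @rsum_exists_ge0 (fun g => `|a g| + a g).
- by move=> g; have := ler_norm (- a g); rewrite normrN; lra.
- apply: (bounded_sums_le (b := fun g => `|a g| + `|a g|)); last exact: bounded_sumsD.
  by move=> g; rewrite lerD2l ler_norm.
move=> l2 h2; exists (l2 - l1); have := rsumB h2 h1.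
by congr rsum; apply/funext => g; ring.
Qed.

Lemma normc_le_ReIm (z : R[i]) : normc z <= `|complex.Re z| + `|complex.Im z|.
Proof.
case: z => x y; rewrite /Normc.normc /= -(@ler_pXn2r _ 2) ?nnegrE ?sqrtr_ge0 ?addr_ge0 //.
rewrite sqr_sqrtr ?addr_ge0 ?sqr_ge0 // sqrrD !real_normK ?num_real //.
by rewrite lerD2r lerDl mulrn_wge0 // mulr_ge0.
Qed.

Lemma Re_le_normc (z : R[i]) : `|complex.Re z| <= normc z.
Proof.
case: z => x y; rewrite /Normc.normc /= -sqrtr_sqr ler_wsqrtr // lerDl sqr_ge0 //.
Qed.

Lemma Im_le_normc (z : R[i]) : `|complex.Im z| <= normc z.
Proof.
case: z => x y; rewrite /Normc.normc /= -sqrtr_sqr ler_wsqrtr // lerDr sqr_ge0 //.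
Qed.

Lemma csum_exists h : bounded_sums (fun g => normc (h g)) -> exists l, csum h l.
Proof.
move=> hb.
have [|lr hr] := @rsum_exists (fun g => complex.Re (h g)).
  by apply: bounded_sums_le hb => g; apply: Re_le_normc.
have [|li hi] := @rsum_exists (fun g => complex.Im (h g)).
  by apply: bounded_sums_le hb => g; apply: Im_le_normc.
exists (Complex lr li) => e e0; have e2 : 0 < e / 2 by rewrite divr_gt0.
have [F1 h1] := hr _ e2; have [F2 h2] := hi _ e2.
exists (F1 `|` F2)%fset => F; rewrite fsubUset => /andP[/h1 + /h2].
move=> hA hB; apply: le_lt_trans (normc_le_ReIm _) _; rewrite [e]splitr.
have ReE : complex.Re (Complex lr li - \sum_(g <- F) h g) = lr - \sum_(g <- F) complex.Re (h g).
  rewrite -(big_morph (@complex.Re R) (op1 := +%R) (id1 := 0) (op2 := +%R) (id2 := 0)) //; last by move=> [? ?] [? ?].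
  by case: (\sum_(_ <- _) _).
have ImE : complex.Im (Complex lr li - \sum_(g <- F) h g) = li - \sum_(g <- F) complex.Im (h g).
  rewrite -(big_morph (@complex.Im R) (op1 := +%R) (id1 := 0) (op2 := +%R) (id2 := 0)) //; last by move=> [? ?] [? ?].
  by case: (\sum_(_ <- _) _).
by rewrite ReE ImE ltrD.
Qed.

Lemma csumB h k l l' : csum h l -> csum k l' -> csum (fun g => h g - k g) (l - l').
Proof.
move=> ha hb e e0; have e2 : 0 < e / 2 by rewrite divr_gt0.
have [F1 h1] := ha _ e2; have [F2 h2] := hb _ e2.
exists (F1 `|` F2)%fset => F; rewrite fsubUset => /andP[/h1 + /h2].
rewrite sumrB; set A := \sum_(_ <- _) _; set B := \sum_(_ <- _) _ => hA hB.
have -> : l - l' - (A - B) = (l - A) + - (l' - B) by ring.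
by rewrite [e]splitr (le_lt_trans (le_normcD _ _)) // normcN ltrD.
Qed.

Lemma csum_sum h l : csum h l -> summability.sum (h : T -> R[i]^o) = l.
Proof.
move=> hl; have PF : ProperFilter (@summability.totally T) := @summability.totally_filter T.
apply: norm_cvg_lim; apply/cvgrPdist_lt => -[x y]; rewrite ltcE /= => /andP[/eqP y0 x0].
have [F0 hF0] := hl _ x0; exists F0 => // F /= FF.
rewrite /summability.partial_sum -(big_seq_fsetE _ _ xpredT h) /=.
by rewrite ltcE /= y0 eqxx; apply: hF0.
Qed.

Lemma summable_bounded a : (forall g, 0 <= a g) ->
  summable [set: T]%classic (fun g => (a g)%:E) <-> bounded_sums a.
Proof.
move=> a0; have absE : (fun g => `|(a g)%:E|%E) = (fun g => (a g)%:E).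
  by apply/funext => g; rewrite gee0_abs // lee_fin.
rewrite /summable absE; split=> [h|[M hM]].
  have fF (F : {fset T}) : ((\sum_(g <- F) a g)%:E <= \esum_(x in [set: T]%classic) (a x)%:E)%E.
    apply: esum_ge; exists [set` F]%classic; first by split.
    by rewrite fsbig_finite //= set_fsetK sumEFin.
  move: h fF; case: (\esum_(x in _) _)%E => [r _ fF|//|_ fF].
    by exists r => F; have := fF F; rewrite lee_fin.
  by exists 0 => F; have := fF F; rewrite leeNy_eq.
apply: (@le_lt_trans _ _ M%:E); last exact: ltry.
apply: ub_ereal_sup => _ [A [finA _] <-].
by rewrite fsbig_finite //= sumEFin lee_fin.
Qed.

End UnorderedSums.

Local Open Scope classical_set_scope.
(** * Limits of the damped vectors *)
Lemma cvg_sumr (R : realType) (I : Type) (r : seq I) (f : I -> R ^nat) (l : I -> R) :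
  (forall i, f i @ \oo --> l i) ->
  (fun k => \sum_(i <- r) f i k) @ \oo --> \sum_(i <- r) l i.
Proof. by move=> h; apply: cvg_big => // -[x y]; apply: add_continuous. Qed.

Section KernelProjection.
Variables (R : realType) (m n : nat) (B : 'M[formal_sum m]_n) (G : groupType) (s : 'I_m -> G).
Hypothesis G_rf : residually_finite G.
Hypothesis sa : self_adjoint (gr_mx s B).
Variable C : nat.
Hypothesis B_C : (l1_norm B ^ 2 <= C)%N.
Hypothesis C_gt0 : (0 < C)%N.
Local Notation es := (entries n (raw_rows B)).
Let B_sym := self_adjoint_symmetric sa.
Local Notation u := (gap_coef B s C).
Local Notation diag := (gap_moment B s C).

Let C0 : (0 : R) < C%:R. Proof. by rewrite ltr0n. Qed.
Let Cn0 : (C%:R : R) != 0. Proof. by rewrite gt_eqF. Qed.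
Let Ck0 k : (0 : R) < C%:R ^+ k. Proof. exact: exprn_gt0. Qed.

(** <T^k e_i, e_i> with T = 1 - A^2/C. *)
Definition moment (i : 'I_n) (k : nat) : R := (diag k i)%:~R / C%:R ^+ k.
(** The coefficient at (j, g) of T^k e_i. *)
Definition damped_coef (i j : 'I_n) (g : G) (k : nat) : R := (u k i j g)%:~R / C%:R ^+ k.

Lemma moment_ge0 i k : 0 <= moment i k.
Proof. by rewrite divr_ge0 // ?(ltW (Ck0 _)) // ler0z gap_moment_ge0. Qed.

Lemma moment_decrS i k : moment i k.+1 <= moment i k.
Proof.
rewrite /moment ler_pdivrMr // exprS mulrCA mulfVK ?gt_eqF //.
by have := gap_moment_decr G_rf B_sym B_C k i; rewrite -(ler_int R) rmorphM /= rmorph_nat.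
Qed.

Lemma moment_decr i : {homo moment i : k l / (k <= l)%N >-> l <= k}.
Proof. by apply/nonincreasing_seqP => k; apply: moment_decrS. Qed.

Lemma moment_le1 i k : moment i k <= 1.
Proof.
apply: le_trans (moment_decr i (leq0n k)) _.
by rewrite /moment /gap_moment /gap_coef coef_fpow0 !eqxx expr0 divr1.
Qed.

Lemma moment_cvg i : cvgn (moment i).
Proof.
apply: nonincreasing_is_cvgn; first exact: moment_decr.
by exists 0 => _ [k _ <-]; apply: moment_ge0.
Qed.

Lemma damped_coef_cauchy i j g l k : (damped_coef i j g l - damped_coef i j g k) ^+ 2 <=
  moment i (l + l) - 2 * moment i (l + k) + moment i (k + k).
Proof.
have := gap_coef_cauchy G_rf B_sym C l k i j g; rewrite -(ler_int R).
rewrite !(rmorphD, rmorphB, rmorphN, rmorphM, rmorphXn) /= !rmorph_nat => h.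
rewrite -(ler_pM2l (Ck0 ((l + l) + (k + k)))).
apply: le_trans (le_trans h _); rewrite le_eqVlt; apply/orP; left; apply/eqP.
  by rewrite /damped_coef !exprD; field; rewrite !expf_neq0.
by rewrite /moment !exprD; field; rewrite !expf_neq0.
Qed.

Lemma damped_coef_cvg i j g : cvgn (damped_coef i j g).
Proof.
apply: cauchy_cvg; apply: cauchy_exP => e e0.
have e2 : 0 < e ^+ 2 / 2 by rewrite divr_gt0 ?exprn_gt0.
have /cvgrPdist_lt/(_ _ e2) [N _ hN] := @moment_cvg i.
exists (damped_coef i j g N); exists N => // k /= Nk; rewrite /ball /=.
rewrite -(@ltr_pXn2r _ 2) ?nnegrE ?normr_ge0 ?(ltW e0) // real_normK ?num_real //.
apply: le_lt_trans (damped_coef_cauchy _ _ _ _ _) _.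
set L := limn _ in hN; have Lle := nonincreasing_cvgn_ge (moment_decr i) (@moment_cvg i).
have h1 := hN (N + N)%N (leq_addr _ _); have h2 := hN (k + k)%N (leq_trans Nk (leq_addr _ _)).
have := Lle (N + k)%N; rewrite -/L => h3.
move: h1 h2 => /=; rewrite distrC ltr_norml => /andP[_ h1]; rewrite distrC ltr_norml => /andP[_ h2].
by lra.
Qed.

Definition ker_proj (i j : 'I_n) (g : G) : R := limn (damped_coef i j g).

Lemma damped_coef_bessel i j (F : {fset G}) l : \sum_(g <- F) damped_coef i j g l ^+ 2 <= 1.
Proof.
apply: le_trans (moment_le1 i (l + l)).
have := @gap_coef_bessel _ _ B _ s G_rf B_sym C l i [seq (j, g) | g <- F].
rewrite map_inj_uniq ?fset_uniq; last by move=> ? ? [].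
rewrite big_map -(ler_int R) rmorph_sum /= => /(_ isT) h.
rewrite /moment ler_pdivlMr // mulr_suml; apply: le_trans h.
rewrite le_eqVlt; apply/orP; left; apply/eqP; apply: eq_bigr => g _.
by rewrite rmorphXn /= /damped_coef exprD; field; rewrite expf_neq0.
Qed.

Lemma proj_bessel i j (F : {fset G}) : \sum_(g <- F) ker_proj i j g ^+ 2 <= 1.
Proof.
have hl : (fun l => \sum_(g <- F) damped_coef i j g l ^+ 2) @ \oo --> \sum_(g <- F) ker_proj i j g ^+ 2.
  by apply: cvg_sumr => g; have h := @damped_coef_cvg i j g; exact: (cvgM h h).
by apply: (cvgr_to_le hl); apply: nearW => l; apply: damped_coef_bessel.
Qed.

(** The squared entries of A T^k e_i are bounded by C times differences of
    consecutive moments, which tend to 0. *)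
Lemma proj_kernel i j g :
  \sum_i' \sum_(t <- B i' j) t.1%:~R * ker_proj i i' (g * (word_val s t.2)^-1)%g = 0 :> R.
Proof.
pose f l : R := \sum_i' \sum_(t <- B i' j) t.1%:~R * damped_coef i i' (g * (word_val s t.2)^-1)%g l.
have f1 : f @ \oo --> \sum_i' \sum_(t <- B i' j) t.1%:~R * ker_proj i i' (g * (word_val s t.2)^-1)%g.
  by do 2! (apply: cvg_sumr => ?); apply: cvgMl_tmp; apply: damped_coef_cvg.
have fE l : f l = (apply_mx B s (u l i) j g)%:~R / C%:R ^+ l.
  rewrite /apply_mx rmorph_sum mulr_suml; apply: eq_bigr => i' _.
  rewrite rmorph_sum mulr_suml; apply: eq_bigr => t _.
  by rewrite rmorphM /= -mulrA.
have f2 l : f l ^+ 2 <= C%:R * (moment i (l + l) - moment i (l + l).+1).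
  have := gap_coef_kernel G_rf B_sym C l i j g; rewrite -(ler_int R).
  rewrite !(rmorphD, rmorphB, rmorphN, rmorphM, rmorphXn) /= !rmorph_nat => h.
  rewrite -(ler_pM2l (Ck0 (l + l))).
  apply: le_trans (le_trans h _); rewrite le_eqVlt; apply/orP; left; apply/eqP.
    by rewrite fE !exprD; field; rewrite !expf_neq0.
  by rewrite /moment exprS !exprD; field; rewrite !expf_neq0 ?Cn0.
have f3 : f @ \oo --> (0 : R).
  apply/cvgrPdist_lt => e e0.
  have e2 : 0 < e ^+ 2 / (2 * C%:R) by rewrite divr_gt0 ?exprn_gt0 ?mulr_gt0.
  have /cvgrPdist_lt/(_ _ e2) [N _ hN] := @moment_cvg i.
  exists N => // l /= Nl; rewrite sub0r normrN.
  rewrite -(@ltr_pXn2r _ 2) ?nnegrE ?normr_ge0 ?(ltW e0) // real_normK ?num_real //.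
  apply: le_lt_trans (f2 l) _.
  have h1 := hN (l + l)%N (leq_trans Nl (leq_addr _ _)).
  have Lle := nonincreasing_cvgn_ge (moment_decr i) (@moment_cvg i) (l + l).+1.
  rewrite mulrC -ltr_pdivlMr //; apply: le_lt_trans (_ : _ <= moment i (l + l) - limn (moment i)) _.
    by rewrite lerD2l lerN2.
  move: h1; rewrite /= distrC ltr_norml => /andP[_ h1]; apply: lt_le_trans h1 _.
  have -> : e ^+ 2 / (2 * C%:R) = e ^+ 2 / C%:R / 2 by field; rewrite Cn0.
  have : 0 < e ^+ 2 / C%:R by rewrite divr_gt0 ?exprn_gt0.
  by lra.
exact: (cvg_unique _ f1 f3).
Qed.

End KernelProjection.

(** * Inner products of square-summable functions *)
Section ComplexNorm.
Variable R : realType.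

Lemma normc_conj (z : R[i]) : normc z^* = normc z.
Proof. by case: z => x y; rewrite /Normc.normc /= sqrrN. Qed.

Lemma normc_real (x : R) : normc x%:C%C = `|x|.
Proof. by rewrite /Normc.normc /= expr0n /= addr0 sqrtr_sqr. Qed.

Lemma normc_nneg (z : R[i]) : 0 <= normc z.
Proof. by case: z => x y; apply: sqrtr_ge0. Qed.

Lemma normc_sum (I : Type) (r : seq I) (F : I -> R[i]) :
  normc (\sum_(i <- r) F i) <= \sum_(i <- r) normc (F i).
Proof.
elim/big_rec2: _ => [|i x y _ h]; first by rewrite Normc.normc0.
by apply: le_trans (le_normcD _ _) _; rewrite lerD2l.
Qed.

Lemma mul_conj_normc (z : R[i]) : z * z^* = (normc z ^+ 2)%:C%C.
Proof.
case: z => x y; rewrite /Normc.normc /= sqr_sqrtr ?addr_ge0 ?sqr_ge0 //.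
apply/eqP; rewrite eq_complex /=; apply/andP; split; apply/eqP; ring.
Qed.

End ComplexNorm.

Section InnerProduct.
Variables (R : realType) (G : groupType) (n : nat).
Implicit Types (x y z : tuple_fun R G n).

Lemma l2P x : l2 x <-> forall j, bounded_sums (fun g => normc (x j g) ^+ 2).
Proof. by split=> h j; apply/summable_bounded => // g; apply: sqr_ge0. Qed.

Lemma l2B x y : l2 x -> l2 y -> l2 (fun j g => x j g - y j g).
Proof.
move=> /l2P hx /l2P hy; apply/l2P => j.
have h := bounded_sumsD (hx j) (hy j).
apply: (bounded_sums_le _ (bounded_sumsD h h)) => g.
have := le_normcD (x j g) (- y j g); rewrite normcN.
have := normc_nneg (x j g - y j g); have := sqr_ge0 (normc (x j g) - normc (y j g)).
set a := normc (x j g); set b := normc (y j g); set c := normc _ => h1 h2 h3.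
apply: (@le_trans _ _ ((a + b) ^+ 2)); first by rewrite lerXn2r ?nnegrE // (le_trans h2).
nra.
Qed.

Lemma csum_inner_exists x y j : l2 x -> l2 y ->
  exists l, csum (fun g => x j g * (y j g)^*) l.
Proof.
move=> /l2P hx /l2P hy; apply: csum_exists.
apply: (bounded_sums_le _ (bounded_sumsD (hx j) (hy j))) => g.
rewrite Normc.normcM normc_conj.
have := sqr_ge0 (normc (x j g) - normc (y j g)).
have := normc_nneg (x j g); have := normc_nneg (y j g).
set a := normc _; set b := normc _; nra.
Qed.

Lemma inner_csum x y (l : 'I_n -> R[i]) :
  (forall j, csum (fun g => x j g * (y j g)^*) (l j)) -> inner x y = \sum_j l j.
Proof. by move=> h; apply: eq_bigr => j _; apply: csum_sum. Qed.

Lemma innerB x x' y : l2 x -> l2 x' -> l2 y ->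
  inner (fun j g => x j g - x' j g) y = inner x y - inner x' y.
Proof.
move=> hx hx' hy.
have [l hl] := choice (fun j => csum_inner_exists j hx hy).
have [l' hl'] := choice (fun j => csum_inner_exists j hx' hy).
rewrite (inner_csum hl) (inner_csum hl') -sumrB; apply: inner_csum => j.
by have := csumB (hl j) (hl' j); congr csum; apply/funext => g; rewrite mulrBl.
Qed.

Lemma csum_single (h : G -> R[i]) g0 : (forall g, g != g0 -> h g = 0) -> csum h (h g0).
Proof.
move=> h0 e e0; exists [fset g0]%fset => F; rewrite fsub1set => hF.
rewrite (big_fsetD1 _ hF) /= big_seq big1 ?addr0 ?subrr ?Normc.normc0 // => g.
by rewrite !inE => /andP[/h0].
Qed.

Lemma inner_self_eq0 x : l2 x -> inner x x = 0 -> x = (fun _ _ => 0).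
Proof.
move=> hx; have [l hl] := choice (fun j => csum_inner_exists j hx hx).
have hr j g : csum (fun g => x j g * (x j g)^*) (l j) -> normc (x j g) ^+ 2 <= complex.Re (l j).
  move=> {}hl; rewrite leNgt; apply/negP => lt.
  have [|F0 hF0] := hl (normc (x j g) ^+ 2 - complex.Re (l j)); first by rewrite subr_gt0.
  have := hF0 (F0 `|` [fset g])%fset (fsubsetUl _ _); set F := (_ `|` _)%fset.
  have gF : g \in F by rewrite !inE eqxx orbT.
  under eq_bigr do rewrite mul_conj_normc.
  rewrite -(rmorph_sum (real_complex R)) /=; set S := \sum_(_ <- _) _.
  have gS : normc (x j g) ^+ 2 <= S.
    by rewrite /S (big_fsetD1 _ gF) /= lerDl sumr_ge0 // => ? _; apply: sqr_ge0.
  move/(le_lt_trans (Re_le_normc _)); case: (l j) lt => a b /= lt.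
  by rewrite ltNge; apply/negP; rewrite negbK distrC ger0_norm; lra.
rewrite (inner_csum hl) => /(congr1 (@complex.Re R)).
rewrite (big_morph (@complex.Re R) (op1 := +%R) (id1 := 0) (op2 := +%R) (id2 := 0)) //; last by move=> [? ?] [? ?].
have l_ge0 j : 0 <= complex.Re (l j) by apply: le_trans (hr j 1%g (hl j)); apply: sqr_ge0.
move=> /eqP; rewrite psumr_eq0 //.
move=> /allP l0; apply/funext => j; apply/funext => g.
have := hr j g (hl j); have /eqP -> := l0 j (mem_index_enum _).
rewrite le_eqVlt ltNge sqr_ge0 orbF expf_eq0 /= => /eqP.
exact: Normc.eq0_normc.
Qed.

Lemma l2_unit_vec i : l2 (unit_vec R i : tuple_fun R G n).
Proof.
apply/l2P => j; exists 1 => F.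
have hE g : normc (unit_vec R i j g) ^+ 2 = ((j == i) && (g == 1%g))%:R :> R.
  by rewrite /unit_vec; case: (_ && _); rewrite ?Normc.normc1 ?Normc.normc0 ?expr1n ?expr0n.
under eq_bigr do rewrite hE.
have [hF|hF] := boolP (1%g \in F).
  rewrite (big_fsetD1 _ hF) /= big_seq big1 ?addr0; first by case: (_ && _).
  by move=> g; rewrite !inE => /andP[/negbTE-> _]; rewrite andbF.
rewrite big_seq big1 // => g gF; have [g1|_] := eqVneq g 1%g; last by rewrite andbF.
by rewrite -g1 gF in hF.
Qed.

Lemma inner_unit_vec x i : inner x (unit_vec R i) = x i 1%g.
Proof.
rewrite (inner_csum (l := fun j => if j == i then x i 1%g else 0)).
  by rewrite (bigD1 i) //= eqxx big1 ?addr0 // => j /negbTE->.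
move=> j; have := @csum_single (fun g => x j g * (unit_vec R i j g)^*) 1%g.
rewrite /unit_vec eqxx andbT; case: eqVneq => [->|ji] /=.
  by rewrite conjC1 mulr1; apply => g /negbTE->; rewrite mulr0n conjC0 mulr0.
by rewrite mulr0n conjC0 mulr0; apply => g _; rewrite ?mulr0n ?conjC0 mulr0.
Qed.

Lemma inner_unit_vecl y i : inner (unit_vec R i) y = (y i 1%g)^*.
Proof.
rewrite (inner_csum (l := fun j => if j == i then (y i 1%g)^* else 0)).
  by rewrite (bigD1 i) //= eqxx big1 ?addr0 // => j /negbTE->.
move=> j; have := @csum_single (fun g => unit_vec R i j g * (y j g)^*) 1%g.
rewrite /unit_vec eqxx andbT; case: eqVneq => [->|ji] /=.
  by rewrite mul1r; apply => g /negbTE->; rewrite mul0r.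
by rewrite mul0r; apply => g _; rewrite mul0r.
Qed.

End InnerProduct.

(** * The projection onto the kernel *)
Section Projection.
Variables (R : realType) (m n : nat) (B : 'M[formal_sum m]_n) (G : groupType) (s : 'I_m -> G).
Hypothesis G_rf : residually_finite G.
Hypothesis sa : self_adjoint (gr_mx s B).
Variable C : nat.
Hypothesis B_C : (l1_norm B ^ 2 <= C)%N.
Hypothesis C_gt0 : (0 < C)%N.
Local Notation es := (entries n (raw_rows B)).
Local Notation coefR := (@damped_coef R m n B G s C).
Local Notation pr := (@ker_proj R m n B G s C).
Local Notation ker := [set x : tuple_fun R G n | l2 x /\ right_mul (gr_mx s B) x = (fun _ _ => 0)].

Definition projC (i : 'I_n) : tuple_fun R G n := fun j g => (pr i j g)%:C%C.

Lemma projC_ker i : ker (projC i).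
Proof.
split.
  apply/l2P => j; exists 1 => F; apply: le_trans (proj_bessel R G_rf sa B_C C_gt0 i j F).
  by rewrite le_eqVlt; apply/orP; left; apply/eqP; apply: eq_bigr => g _;
    rewrite normc_real real_normK ?num_real.
apply/funext => j; apply/funext => g; rewrite right_mul_gr.
have := proj_kernel R G_rf sa B_C C_gt0 i j g => /(congr1 (real_complex R)) /=.
rewrite rmorph0 rmorph_sum /= => h; rewrite -[RHS]h; apply: eq_bigr => i' _.
rewrite rmorph_sum /=; apply: eq_bigr => t _.
by rewrite rmorphM /= rmorph_int.
Qed.

Lemma pairing_damped_coef (y : tuple_fun R G n) (i : 'I_n) k (S : {fset G}) :
  right_mul (gr_mx s B) y = (fun _ _ => 0) ->
  {subset vals s (fpow C es k i) <= S} ->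
  \sum_j \sum_(g <- S) (coefR i j g k)%:C%C * (y j g)^* = (y i 1%g)^*.
Proof.
move=> y0 hS.
have := pairing_fpow sa C k i y0; rewrite (pairing_coef _ hS) => h.
have Ck : (C%:R ^+ k : R[i]) != 0 by rewrite expf_neq0 // pnatr_eq0 -lt0n.
rewrite -[y i 1%g](mulKf Ck) -h rmorphM /= rmorph_sum /= mulr_sumr; apply: eq_bigr => j _.
rewrite rmorph_sum /= mulr_sumr; apply: eq_bigr => g _.
rewrite raddfMz /= -mulrzl mulrA; congr (_ * _).
rewrite fmorphV rmorphXn /= rmorph_nat mulrC /damped_coef.
by rewrite rmorphM /= rmorph_int fmorphV rmorphXn /= rmorph_nat.
Qed.

(** Outside a finite set F0 that carries almost all of the norm of y, the
    vectors contribute little to the inner product with y: apply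
    ab <= (e a^2 + b^2/e)/2 termwise, with the norms of the vectors at most 1. *)
Lemma damped_coef_tail i j k (y : G -> R[i]) (S F0 : {fset G}) e : 0 < e ->
  \sum_(g <- (S `\` F0)%fset) normc (y g) ^+ 2 <= e ^+ 2 ->
  \sum_(g <- (S `\` F0)%fset) `|pr i j g - coefR i j g k| * normc (y g) <= 3 * e.
Proof.
move=> e0 hy; set D := (S `\` F0)%fset in hy *.
have hp := proj_bessel R G_rf sa B_C C_gt0 i j D.
have hu := damped_coef_bessel R G_rf sa B_C C_gt0 i j D k.
apply: (@le_trans _ _ (\sum_(g <- D) (e * (pr i j g ^+ 2 + coefR i j g k ^+ 2)
    + normc (y g) ^+ 2 / e))).
  apply: ler_sum => g _; set a := pr _ _ _; set b := coefR _ _ _ _; set c := normc _.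
  have c0 : 0 <= c := normc_nneg _.
  rewrite -(ler_pM2l e0) mulrDr [e * (c ^+ 2 / e)]mulrC mulfVK ?gt_eqF //.
  have := sqr_ge0 (e * `|a - b| - c); have := real_normK (num_real (a - b)).
  have := sqr_ge0 (a + b); set x := `|a - b| => h1 h2 h3.
  have e2 : 0 <= e ^+ 2 by rewrite sqr_ge0.
  have h4 : x ^+ 2 <= 2 * (a ^+ 2 + b ^+ 2) by rewrite h2; nra.
  have h5 : e ^+ 2 * x ^+ 2 <= e ^+ 2 * (2 * (a ^+ 2 + b ^+ 2)) by rewrite ler_wpM2l.
  nra.
rewrite big_split /= -mulr_sumr -mulr_suml big_split /=.
have h1 : e * (\sum_(g <- D) pr i j g ^+ 2 + \sum_(g <- D) coefR i j g k ^+ 2) <= e * 2.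
  by rewrite ler_wpM2l ?(ltW e0) //; lra.
have h2 : (\sum_(g <- D) normc (y g) ^+ 2) / e <= e.
  by rewrite ler_pdivrMr // -expr2.
lra.
Qed.

(** Pointwise convergence of T^k e_i with bounded norms gives weak convergence,
    and the pairings of T^k e_i with y are all equal to that of e_i. Per
    coordinate, the tolerance e is spent once on the tail of the series for p_i
    and three times on the tail of y; once more in total it is spent on the
    finite set F0, whence eps = (4n + 1) e. *)
Lemma proj_weak (y : tuple_fun R G n) i : ker y -> inner (projC i) y = (y i 1%g)^*.
Proof.
case=> hy y0; have hp := (projC_ker i).1.
have [l hl] := choice (fun j => csum_inner_exists j hp hy).
rewrite (inner_csum hl); set c := (y i 1%g)^*.
apply/eqP; rewrite -subr_eq0; apply/eqP; apply: Normc.eq0_normc.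
apply/eqP; rewrite eq_le normc_nneg andbT; apply/ler_addgt0Pr => eps eps0; rewrite add0r.
pose e := eps / (4 * n%:R + 1) : R.
have n4 : (0 : R) < 4 * n%:R + 1 by rewrite ltr_wpDl // mulr_ge0.
have e0 : 0 < e by rewrite divr_gt0.
have epsE : eps = (4 * n%:R + 1) * e by rewrite /e mulrC mulfVK ?gt_eqF.
clearbody e.
have [F1 hF1] := choice (fun j => hl j e e0).
have tail j : exists F : {fset G}, forall S : {fset G}, (F `<=` S)%fset ->
    \sum_(g <- (S `\` F)%fset) normc (y j g) ^+ 2 <= e ^+ 2.
  have [L hL] := rsum_exists_ge0 (fun g => sqr_ge0 (normc (y j g))) ((l2P y).1 hy j).
  have e2 : 0 < e ^+ 2 / 2 by rewrite divr_gt0 ?exprn_gt0.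
  have [F hF] := hL _ e2; exists F => S FS.
  have := hF _ FS; have := hF _ (fsubset_refl F).
  rewrite [X in _ -> `|L - X| < _ -> _](big_fsetID _ (mem F)) /=.
  have -> : [fset x in S | x \in F]%fset = F.
    by apply/fsetP => x; rewrite !inE andb_idl // => /(fsubsetP FS).
  have -> : [fset x in S | x \notin F]%fset = (S `\` F)%fset.
    by apply/fsetP => x; rewrite !inE andbC.
  set A := \sum_(_ <- F) _; set D := \sum_(_ <- _) _.
  rewrite !ltr_norml => /andP[h1 h2] /andP[h3 h4]; lra.
have [F2 hF2] := choice tail.
(* One finite set for all coordinates: the series for <p_i, y> and for |y|^2 are
   almost exhausted on it. *)
pose F0 := (\bigcup_(j <- enum 'I_n) (F1 j `|` F2 j))%fset.
have F1F0 j : (F1 j `<=` F0)%fset.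
  by apply: fsubset_trans (fsubsetUl _ (F2 j)) _; apply: (bigfcup_sup (P := xpredT)); rewrite ?mem_enum.
have F2F0 j : (F2 j `<=` F0)%fset.
  by apply: fsubset_trans (fsubsetUr (F1 j) _) _; apply: (bigfcup_sup (P := xpredT)); rewrite ?mem_enum.
pose D k := \sum_j \sum_(g <- F0) `|pr i j g - coefR i j g k| * normc (y j g).
have D0 : D @ \oo --> \sum_(j < n) \sum_(g <- F0) 0 * normc (y j g).
  apply: cvg_sumr => j; apply: cvg_sumr => g; apply: cvgMr_tmp.
  apply/norm_cvg0P; rewrite -(subrr (pr i j g)); apply: cvgB; first exact: cvg_cst.
  exact: damped_coef_cvg.
have /cvgrPdist_lt/(_ e e0) [k _ /(_ k (leqnn k)) hk] := D0.
have {}hk : D k < e.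
  move: hk => /=; rewrite big1 ?sub0r ?normrN; last by move=> j _; rewrite big1 // => g _; rewrite mul0r.
  by apply: le_lt_trans; apply: ler_norm.
(* On S the pairing of T^k e_i with y is exact. *)
pose S := (F0 `|` [fset g in vals s (fpow C es k i)])%fset.
have hS : {subset vals s (fpow C es k i) <= S} by move=> g hg; rewrite !inE hg orbT.
have F0S : (F0 `<=` S)%fset by apply: fsubsetUl.
rewrite /c -(pairing_damped_coef y0 hS).
have -> : \sum_j l j - \sum_j \sum_(g <- S) (coefR i j g k)%:C%C * (y j g)^* =
  \sum_j ((l j - \sum_(g <- S) projC i j g * (y j g)^*) +
    \sum_(g <- S) (pr i j g - coefR i j g k)%:C%C * (y j g)^*).
  rewrite -sumrB; apply: eq_bigr => j _; rewrite -[RHS]addrA; congr (_ + _).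
  rewrite -!sumrN -big_split /=; apply: eq_bigr => g _.
  by rewrite /projC rmorphB /=; ring.
apply: le_trans (normc_sum _ _) _.
apply: (@le_trans _ _ (\sum_j (e + (\sum_(g <- F0) `|pr i j g - coefR i j g k| * normc (y j g) + 3 * e)))).
  apply: ler_sum => j _; apply: le_trans (le_normcD _ _) _; apply: lerD.
    by apply/ltW/hF1; apply: fsubset_trans F0S.
  apply: le_trans (normc_sum _ _) _.
  under eq_bigr do rewrite Normc.normcM normc_conj normc_real.
  rewrite (big_fsetID _ (mem F0)) /=.
  have -> : [fset x in S | x \in F0]%fset = F0.
    by apply/fsetP => x; rewrite !inE andb_idl // => ->.
  have -> : [fset x in S | x \notin F0]%fset = (S `\` F0)%fset.
    by apply/fsetP => x; rewrite !inE; case: (x \in F0); rewrite /= ?andbF ?andbT.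
  rewrite lerD2l; apply: damped_coef_tail => //.
  apply: le_trans (hF2 j S (fsubset_trans (F2F0 j) F0S)).
  apply: big_fset_le; first by move=> g; apply: sqr_ge0.
  exact: fsetDS.
rewrite big_split /= big_split /= !sumr_const card_ord -/(D k).
have -> : eps = e *+ n + (e + (3 * e) *+ n).
  by rewrite epsE -[e *+ n]mulr_natl -[(3 * e) *+ n]mulr_natl; ring.
by rewrite lerD2l lerD2r ltW.
Qed.

Lemma projC_orth i : is_orth_proj ker (unit_vec R i) (projC i).
Proof.
split; first exact: projC_ker.
move=> v kv; rewrite innerB ?inner_unit_vecl ?proj_weak ?subrr //.
- exact: l2_unit_vec.
- exact: (projC_ker i).1.
- exact: kv.1.
Qed.

Lemma right_mulB (x y : tuple_fun R G n) :
  right_mul (gr_mx s B) (fun j g => x j g - y j g) =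
  (fun j g => right_mul (gr_mx s B) x j g - right_mul (gr_mx s B) y j g).
Proof.
apply/funext => j; apply/funext => g; rewrite /right_mul -sumrB; apply: eq_bigr => i _.
by rewrite -sumrB; apply: eq_bigr => h _; rewrite mulrBr.
Qed.

(** The choice made by [orth_proj] is harmless: the difference of two projections
    lies in the kernel and is orthogonal to it. *)
Lemma ker_orth_proj i : orth_proj ker (unit_vec R i) = projC i.
Proof.
rewrite /orth_proj; case: xgetP => [q _ [kq hq]|/(_ (projC i))]; last first.
  by have := projC_orth i.
have [kp hp] := projC_orth i.
have kd : ker (fun j g => q j g - projC i j g).
  split; first exact: l2B kq.1 kp.1.
  by rewrite right_mulB kq.2 kp.2; apply/funext => j; apply/funext => g; rewrite subrr.
have := hq _ kd; have := hp _ kd.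
have ue := l2_unit_vec R G i.
rewrite (innerB ue kp.1 kd.1) (innerB ue kq.1 kd.1) => h1 h2.
have d0 : inner (fun j g => q j g - projC i j g) (fun j g => q j g - projC i j g) = 0.
  rewrite (innerB kq.1 kp.1 kd.1); apply/eqP; rewrite subr_eq0; apply/eqP.
  by apply: (addIr (- inner (unit_vec R i) (fun j g => q j g - projC i j g)));
    rewrite -[LHS]opprB -[RHS]opprB h1 h2.
have := inner_self_eq0 kd.1 d0 => h; apply/funext => j; apply/funext => g.
by have := congr1 (fun f => f j g) h => /= /eqP; rewrite subr_eq0 => /eqP.
Qed.

Lemma b2_proj : b2 R (gr_mx s B) = \sum_i pr i i 1%g.
Proof.
rewrite /b2 /vn_dim; under eq_bigr do rewrite ker_orth_proj inner_unit_vec /projC.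
by rewrite -rmorph_sum.
Qed.

Lemma sum_moment_cvg : (fun k => \sum_i moment R B s C i k) @ \oo --> b2 R (gr_mx s B).
Proof.
rewrite b2_proj; apply: cvg_sumr => i.
exact: (@damped_coef_cvg R _ _ _ _ _ G_rf sa C B_C C_gt0 i i 1%g).
Qed.

End Projection.

(** * Correctness of the algorithm *)
Lemma sum_le_enc_seq (T : Type) (s : seq T) (c : T -> nat) :
  (\sum_(a <- s) c a <= enc_seq [seq c a | a <- s])%N.
Proof.
elim: s => [|a s IH] /=; first by rewrite big_nil.
rewrite big_cons; apply: leq_trans (leqnSn _); apply: leq_trans (leq_enc_pair _ _).
by rewrite leq_add2l.
Qed.

Lemma abs_le_enc_int z : (`|z|%N <= enc_int z)%N.
Proof.
case: z => k /=; first exact: leq_trans (leq_addl 0 k) (leq_enc_pair _ _).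
exact: leq_trans (leq_enc_pair 1 k).
Qed.

Lemma l1_norm_le_enc (m n : nat) (B : 'M[formal_sum m]_n) : (l1_norm B <= enc_mx B)%N.
Proof.
rewrite /enc_mx; apply: leq_trans (leq_enc_pair _ _); apply: leq_trans (leq_addl _ _).
apply: leq_trans (sum_le_enc_seq _ _); rewrite /l1_norm big_enum /=.
apply: leq_sum => i _; apply: leq_trans (sum_le_enc_seq _ _); rewrite big_enum /=.
apply: leq_sum => j _; apply: leq_trans (sum_le_enc_seq _ _).
apply: leq_sum => t _; apply: leq_trans (abs_le_enc_int _) _.
exact: leq_trans (leq_addr _ _) (leq_enc_pair _ _).
Qed.

Lemma big_ftrace (V : nmodType) C (es : fmat) k n (F : zdiff * rword -> V) :
  \sum_(t <- ftrace C es k n) F t =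
  \sum_(i < n) \sum_(t <- fpow C es k i | t.2.1 == i :> nat) F (t.1, t.2.2).
Proof.
rewrite /ftrace big_flatten big_map -[n in iota 0 n]subn0 -/(index_iota 0 n) big_mkord.
apply: eq_bigr => i _; rewrite big_flatten big_map [RHS]big_mkcond; apply: eq_bigr => t _.
by case: ifP => _; rewrite ?big_nil // big_seq1.
Qed.

Lemma zval_zsum (l : seq (zdiff * rword)) : zval (zsum l) = \sum_(t <- l) zval t.1.
Proof.
elim: l => [|t l IH]; first by rewrite big_nil.
rewrite big_cons -IH (_ : zsum _ = (t.1.1 + (zsum l).1, t.1.2 + (zsum l).2)%N) //.
by rewrite /zval /= !PoszD opprD addrACA.
Qed.

Lemma dec_rat_enc (z : zdiff) d : dec_rat (enc (z, d)) = (zval z)%:~R / d.+1%:R.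
Proof. by rewrite /dec_rat !of_enc_pair /zval rmorphB. Qed.

Section Algorithm.
Variables (P : presentation) (n : nat) (B : 'M[formal_sum (ngen P)]_n).

Definition raw_input : input := ((ngen P, raw_rels P), (n, raw_rows B)).

Lemma enc_raw_word m (w : word m) : enc (raw_word w) = enc_word w.
Proof. by rewrite /enc_word /raw_word [LHS]/(enc_seq _) -map_comp. Qed.

Lemma enc_raw_input : enc raw_input = enc_pair (enc_presentation P) (enc_mx B).
Proof.
have encE (T U : Type) (eU : Enc U) (f : T -> U) (l : seq T) :
  enc [seq f a | a <- l] = enc_seq [seq enc (f a) | a <- l].
  by rewrite [LHS]/(enc_seq _) -map_comp.
rewrite [LHS]/(enc_pair (enc_pair (ngen P) (enc (raw_rels P))) (enc_pair n (enc (raw_rows B)))).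
congr (enc_pair (enc_pair _ _) (enc_pair _ _)).
  by rewrite encE; congr enc_seq; apply: eq_map => r; rewrite enc_raw_word.
rewrite encE; congr enc_seq; apply: eq_map => i.
rewrite encE; congr enc_seq; apply: eq_map => j.
rewrite encE; congr enc_seq; apply: eq_map => -[z w].
rewrite [LHS]/(enc_pair _ (enc (raw_word w))) enc_raw_word.
by case: z.
Qed.

Local Notation x := raw_input.
Local Notation C := (2 ^ expo x)%N.
Local Notation es := (entries n (raw_rows B)).

Lemma C_ge_l1_norm : (l1_norm B ^ 2 <= C)%N.
Proof.
have h : (l1_norm B <= enc x)%N.
  rewrite enc_raw_input; apply: leq_trans (l1_norm_le_enc B) _.
  exact: leq_trans (leq_addl _ _) (leq_enc_pair _ _).
rewrite /expo mulnC expnM leq_sqr; apply: leq_trans h _.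
exact/ltnW/ltn_expl.
Qed.

Lemma C_gt0 : (0 < C)%N. Proof. by rewrite expn_gt0. Qed.

Lemma fmul_raw v : (forall t, t \in v -> exists w : word (ngen P), t.2.2 = raw_word w) ->
  forall t, t \in fmul v es -> exists w : word (ngen P), t.2.2 = raw_word w.
Proof.
move=> hv t /flattenP[l /mapP[t' /hv [w hw] ->]] /flattenP[l' /mapP[e he ->]].
have [w' hw'] : exists w : word (ngen P), e.2.2.2 = raw_word w.
  move: he => /flattenP[l1 /mapP[i hi ->]] /flattenP[l2 /mapP[j hj ->]].
  move: hi hj; rewrite !mem_iota /= => hi hj.
  rewrite (nth_raw_rows B (Ordinal hi) (Ordinal hj)) => /mapP[? /mapP[t'' _ ->] ->] /=.
  by exists t''.2.
case: ifP => // _; rewrite inE => /eqP-> /=.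
by exists (w ++ w'); rewrite hw hw' raw_cat.
Qed.

(** Only words in the actual generators occur, so that soundness of actions,
    which concerns the presented group, applies to them. *)
Lemma fpow_raw K k i t : t \in fpow K es k i -> exists w : word (ngen P), t.2.2 = raw_word w.
Proof.
elim: k t => [|k IH] t /=; first by rewrite inE => /eqP->; exists [::].
rewrite /fstep mem_cat => /orP[/mapP[t' /IH [w hw] ->]|/mapP[t' ht' ->]]; first by exists w.
exact: fmul_raw (fmul_raw IH) _ ht'.
Qed.

Lemma ftrace_raw K k t : t \in ftrace K es k n -> exists w : word (ngen P), t.2 = raw_word w.
Proof.
move=> /flattenP[l /mapP[i _ ->]] /flattenP[l' /mapP[t' /fpow_raw [w hw] ->]].
by case: ifP => // _; rewrite inE => /eqP->; exists w.
Qed.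

Variables (G : groupType) (s : 'I_(ngen P) -> G).
Hypothesis pres : presents s.
Hypothesis G_rf : residually_finite G.
Local Notation val := (rval (gen_val s)).

Lemma check_complete k : exists c, check (x, k) c.
Proof.
have [ws hws] : exists ws : seq (word (ngen P)),
    forall t, t \in trace_terms x k -> exists2 w, w \in ws & t.2 = raw_word w.
  have : forall t, t \in trace_terms x k -> exists w : word (ngen P), t.2 = raw_word w.
    by move=> t; apply: ftrace_raw.
  elim: (trace_terms x k) => [|t l IH] h; first by exists [::].
  have [|ws hws] := IH; first by move=> t' ht'; apply: h; rewrite inE ht' orbT.
  have [|w hw] := h t; first by rewrite inE eqxx.
  exists (w :: ws) => t'; rewrite inE => /orP[/eqP->|/hws [w' h1 h2]].
    by exists w; rewrite ?inE ?eqxx.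
  by exists w'; rewrite // inE h1 orbT.
have [cert hcert] := derived_complete pres ws.
have [E [hE1 hE2]] := fixes_complete pres ws G_rf.
exists (E, cert); rewrite /check /= hE1 /=; apply/allP => t /hws [w hw ->].
have [w1|w1] := eqVneq (word_val s w) 1%g; first by rewrite hcert.
by rewrite hE2 ?orbT.
Qed.

(** On the words of the expansion, membership in the derived list is equivalent to
    triviality: a trivial word is fixed by every valid action, so it can have
    passed the test only by being derived. *)
Lemma check_sound k c t : check (x, k) c -> t \in trace_terms x k ->
  (t.2 \in derived (trivial_words (ngen P) (raw_rels P)) c.2) = (val t.2 == 1%g).
Proof.
move=> /andP[hE /allP hall] ht; apply/idP/eqP; first exact: derived_sound.
have [w hw] := ftrace_raw ht; rewrite hw rval_raw => w1.
by have := hall t ht; rewrite hw (fixes_sound pres hE w1) orbF.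
Qed.

Definition approx (k : nat) : rat :=
  (\sum_i gap_moment B s C (steps x k) i)%:~R / (C%:R ^+ steps x k).

Lemma output_approx k c : check (x, k) c -> dec_rat (enc (output (x, k) c)) = approx k.
Proof.
move=> hc; rewrite dec_rat_enc zval_zsum prednK ?expn_gt0 // natrX; congr (_%:~R / _).
rewrite big_flatten big_map big_seq.
transitivity (\sum_(t <- trace_terms x k) if val t.2 == 1%g then zval t.1 else 0).
  rewrite [RHS]big_seq; apply: eq_bigr => t ht; rewrite (check_sound hc ht).
  by case: ifP => _; rewrite ?big_nil // big_seq1.
rewrite big_ftrace; apply: eq_bigr => i _; rewrite -big_mkcondr /=.
by [].
Qed.

Variable R : realType.
Hypothesis sa : self_adjoint (gr_mx s B).

(** The moments decrease to b2, so they are upper bounds; the rate, valid for all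
    later indices, gives the lower bound in the limit. *)
Lemma approx_b2 k : `|b2 R (gr_mx s B) - ratr (approx k)| <= 2 ^- k.
Proof.
set m := steps x k; pose F l := \sum_i moment R B s C i l.
have Fcvg : F @ \oo --> b2 R (gr_mx s B) := sum_moment_cvg G_rf sa C_ge_l1_norm C_gt0.
have Fdecr : {homo F : l l' / (l <= l')%N >-> l' <= l}.
  by move=> l l' ll'; apply: ler_sum => i _; apply: (moment_decr R G_rf sa C_ge_l1_norm C_gt0 i ll').
have -> : ratr (approx k) = F m.
  rewrite /approx fmorph_div rmorph_int rmorphXn /= ratr_nat rmorph_sum mulr_suml.
  by [].
have FE l : F l = (\sum_i gap_moment B s C l i)%:~R / C%:R ^+ l.
  by rewrite rmorph_sum mulr_suml.
have Ck l : (0 : R) < C%:R ^+ l by rewrite exprn_gt0 // ltr0n C_gt0.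
pose e := cutoff x k; pose c := expo x.
have rate l : (m <= l)%N -> F m - (n * c.+1)%:R / e%:R <= F l.
  move=> ml.
  have e0 : (0 : R) < e%:R by rewrite ltr0n /e /cutoff !muln_gt0 expn_gt0.
  have := gap_moment_rate G_rf (self_adjoint_symmetric sa) C_ge_l1_norm C_gt0 (erefl C)
     (erefl (steps x k)) ml.
  rewrite -(ler_int R) !(rmorphD, rmorphB, rmorphN, rmorphM, rmorphXn) /= !rmorph_nat -/e -/m.
  set S := (\sum_i gap_moment B s C m i)%:~R; set S' := (\sum_i gap_moment B s C l i)%:~R => h.
  rewrite lerBlDr -lerBlDl ler_pdivlMr //.
  rewrite -(ler_pM2r (Ck l)); apply: le_trans (le_trans h _); last by rewrite ?natrM.
  rewrite !FE -/S -/S' -{1}(subnKC ml) le_eqVlt; apply/orP; left; apply/eqP.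
  have := Ck m; have := Ck (l - m)%N; rewrite -(subnKC ml) addKn.
  set a := C%:R ^+ m; rewrite exprD -/a; set b := C%:R ^+ (l - m) => b0 a0.
  by field; rewrite !gt_eqF.
have h1 : b2 R (gr_mx s B) <= F m.
  apply: (cvgr_to_le Fcvg); exists m => // l /= ml; exact: Fdecr.
have h2 : F m - (n * c.+1)%:R / e%:R <= b2 R (gr_mx s B).
  by apply: (cvgr_to_ge Fcvg); exists m => // l /= ml; apply: rate.
rewrite distrC ger0_norm ?subr_ge0 //.
apply: (@le_trans _ _ ((n * c.+1)%:R / e%:R)); first by rewrite lerBlDr -lerBlDl.
rewrite /e /cutoff -/c /= !natrM natrX !invfM.
have c0 : (0 : R) < c.+1%:R by rewrite ltr0n.
have n0 : (0 : R) < n.+1%:R by rewrite ltr0n.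
have p0 : (0 : R) < 2 ^+ k by rewrite exprn_gt0.
have -> : n%:R * c.+1%:R * (c.+1%:R^-1 * n.+1%:R^-1 * (2 ^+ k)^-1) = n%:R / n.+1%:R * (2 ^+ k)^-1 :> R.
  by field; rewrite !gt_eqF.
by rewrite ler_piMl ?invr_ge0 ?(ltW p0) // ler_pdivrMr // mul1r ler_nat.
Qed.

End Algorithm.

Theorem corollary6p7 (R : realType) :
  exists M : prog,
    forall (P : presentation) (n : nat) (B : 'M[formal_sum (ngen P)]_n)
           (G : groupType) (s : 'I_(ngen P) -> G),
      presents s ->
      residually_finite G ->
      self_adjoint (gr_mx s B) ->
      (exists e : prog,
          run M (enc_pair (enc_presentation P) (enc_mx B)) (enc_prog e) /\
          exists q : nat -> rat,
            computes e q /\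
            forall k : nat, `|b2 R (gr_mx s B) - ratr (q k)| <= 2 ^- k) /\
      effectively_computable (b2 R (gr_mx s B)).
Proof.
have [p hp] := computable_search computable_check computable_output.
have [M hM] := computable_spec p.
exists M => P n B G s pres rf sa.
have hq k : `|b2 R (gr_mx s B) - ratr (approx B s k)| <= 2 ^- k by apply: approx_b2.
have he : computes (spec_prog p (enc (raw_input B))) (approx B s).
  move=> k; have [c [hc hrun]] := hp (raw_input B, k) (check_complete B pres rf k).
  by exists (enc (output (raw_input B, k) c)); [exact: run_spec | exact: output_approx].
split; last by exists (approx B s) => //; exists (spec_prog p (enc (raw_input B))).
exists (spec_prog p (enc (raw_input B))); split; last by exists (approx B s).
by rewrite -enc_raw_input; apply: hM.
Qed.
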